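(* Let $\zeta$ be a primitive aperiodic substitution on the two-letter alphabet $\{0,1\}$. For $n\ge1$ let $a(n)$ and $b(n)$ be, respectively, the minimum and the maximum number of $0$'s in allowed words of $\zeta$ of length $n$. (i) If $\gcd\{|\zeta^n(0)|,|\zeta^n(1)|\}=1$ for all $n\ge 1$, then the $\mathbb{Z}$-action $(X_\zeta,\sigma)$ is topologically mixing if and only if $b(n)-a(n)\to\infty$ as $n\to\infty$. (ii) Let $t_0,t_1>0$ be tile lengths. If $t_1/t_0$ is irrational, then the tiling $\mathbb{R}$-action $(X_{\mathcal T},T_g)$ associated with $\zeta$ and $(t_0,t_1)$ is topologically mixing if and only if $b(n)-a(n)\to\infty$ as $n\to\infty$.
   Context: Substitutions. A substitution on a finite alphabet $\mathcal A$ is a map $\zeta$ from $\mathcal A$ to the set of nonempty finite words over $\mathcal A$, extended to words and sequences by concatenation. $|W|$ is the length of a word $W$ and $\ell_i(W)$ is the number of occurrences of the letter $i$ in $W$. The substitution matrix is $M=(m_{i,j})$ with $m_{i,j}=\ell_i(\zeta(j))$. $\zeta$ is primitive if some power $M^k$ has all entries strictly positive. $X_\zeta\subset\mathcal A^{\mathbb Z}$ is the set of all two-sided sequences every finite subword of which occurs in $\zeta^k(i)$ for $k$ sufficiently large; $\sigma$ is the left shift on $X_\zeta$. $\zeta$ is aperiodic if $X_\zeta$ is infinite. The allowed words are the finite words occurring in elements of $X_\zeta$. Tilings. Given tile lengths $t_i>0$ ($i\in\mathcal A$), let the prototile $\tau_i$ be an interval of length $t_i$ labelled by $i$ (labels distinguish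 congruent tiles). $X_{\mathcal T}$ is the set of all tilings $\mathcal S$ of $\mathbb R$ by translates of the $\tau_i$ such that the sequence of labels along every patch (tiling of a finite interval contained in $\mathcal S$) is an allowed word of $\zeta$. The group $\mathbb R$ acts by $T_g(\mathcal S)=\mathcal S-g$. The topology on $X_{\mathcal T}$ has as basis the sets $X_{P,\epsilon}=\{\mathcal S\in X_{\mathcal T}: \exists y\in(-\epsilon,\epsilon),\ P-y\subset\mathcal S\}$, where $P$ is a patch and $\epsilon>0$. Topological mixing. A continuous action $(X,G)$ of $G=\mathbb Z$ or $\mathbb R$ on a compact metrizable space is topologically mixing if for any nonempty open $U,V\subset X$ there is $R>0$ such that $U\cap T_g(V)\ne\emptyset$ for all $g\in G$ with $|g|\ge R$ (for $G=\mathbb Z$, $T_g=\sigma^g$). *)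

(* Defs.v *)
From HB Require Import structures.
From mathcomp Require Import all_boot all_order all_algebra.
From mathcomp Require Import all_classical all_reals all_analysis.

Set Implicit Arguments.
Unset Strict Implicit.
Unset Printing Implicit Defensive.

Import Order.TTheory GRing.Theory Num.Theory.
Import numFieldNormedType.Exports.

Local Open Scope classical_set_scope.
Local Open Scope ring_scope.

(* The group acting is G = int or a realType, with |g| its norm. *)
Definition topologically_mixing (G : realDomainType) (X : topologicalType)
    (T : G -> X -> X) : Prop :=
  forall U V : set X, open U -> open V -> U !=set0 -> V !=set0 ->
  exists2 r : G, 0 < r & forall g : G, r <= `|g| -> U `&` T g @` V !=set0.

Section Substitutions.
Variable m : nat.

Record substitution := Substitution {
  subst_fun :> 'I_m -> seq 'I_m;
  subst_neq_nil : forall i, subst_fun i != [::] }.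

Implicit Types (zeta : substitution) (w : seq 'I_m) (i : 'I_m).

Definition subst_word zeta w : seq 'I_m := flatten [seq zeta i | i <- w].

(* zeta^n(i) *)
Definition subst_iter zeta (n : nat) i : seq 'I_m :=
  iter n (subst_word zeta) [:: i].

Definition subst_mx zeta : 'M[nat]_m := \matrix_(i, j) count_mem i (zeta j).

Definition primitive zeta : Prop :=
  exists2 k : nat, (0 < k)%N & forall i j, (0 < (subst_mx zeta ^+ k) i j)%N.

Definition biseq := {ptws int -> discrete_topology 'I_m}.

(* The word x_i x_(i+1) ... x_(i+n-1). *)
Definition window (x : biseq) (i : int) (n : nat) : seq 'I_m :=
  mkseq (fun k => x (i + k%:Z)) n.

(* Being a subword of zeta^k(i) for all large k is required for each letter i;
   for primitive zeta the choice of letter is immaterial. *)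
Definition subst_seqs zeta : set biseq :=
  [set x | forall (j : int) (n : nat) (i : 'I_m),
    \forall k \near \oo, infix (window x j n) (subst_iter zeta k i)].

Definition aperiodic zeta : Prop := infinite_set (subst_seqs zeta).

Definition allowed zeta w : Prop :=
  exists2 x, subst_seqs zeta x & exists j, window x j (size w) = w.

(* As counts in words of length n are at most n, the identity element n of
   minn does not affect the minimum. *)
Definition min_count zeta i (n : nat) : nat :=
  (\big[minn/n]_(w : n.-tuple 'I_m | `[< allowed zeta w >]) count_mem i w)%N.

Definition max_count zeta i (n : nat) : nat :=
  (\max_(w : n.-tuple 'I_m | `[< allowed zeta w >]) count_mem i w)%N.

(* X_zeta with the topology induced by the product topology. *)
Definition subst_space zeta := set_type (subst_seqs zeta).
HB.instance Definition _ zeta := Topological.on (subst_space zeta).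

(* sigma^g, where sigma is the left shift *)
Definition translate_seq (g : int) (x : biseq) : biseq := fun j => x (j + g).

Lemma translate_seq_subproof zeta g (x : subst_space zeta) :
  translate_seq g (val x) \in subst_seqs zeta.
Proof.
rewrite inE => j n i; have := set_mem (valP x) (j + g) n i.
suff -> : window (val x) (j + g) n = window (translate_seq g (val x)) j n by [].
by apply: eq_mkseq => k; rewrite /translate_seq addrAC.
Qed.

Definition subst_shift zeta (g : int) (x : subst_space zeta) : subst_space zeta :=
  exist (fun y => y \in subst_seqs zeta) _ (translate_seq_subproof g x).

End Substitutions.

Arguments subst_shift {m} zeta g x.

Section Tilings.
Variables (R : realType) (m : nat) (t : 'I_m -> {posnum R}).

(* (x, i) is the translate of the prototile tau_i with left endpoint x. *)
Definition tile : Type := (R * 'I_m)%type.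
HB.instance Definition _ := Choice.on tile.

Implicit Types (T : tile) (P S : set tile).

Definition tile_end T : R := T.1 + (t T.2)%:num.
Definition tile_supp T : set R := `[T.1, tile_end T].
Definition tile_int T : set R := `]T.1, tile_end T[.

Definition tiles P (I : set R) : Prop :=
  \bigcup_(T in P) tile_supp T = I /\ trivIset P tile_int.

Definition is_patch P : Prop := exists c d : R, c < d /\ tiles P `[c, d].

Definition label_word P (w : seq 'I_m) : Prop :=
  exists s : seq tile, [/\ sorted (fun T T' => T.1 < T'.1) s,
    P = [set` s] & w = [seq T.2 | T <- s]].

Variable zeta : substitution m.

Definition subst_tilings : set (set tile) :=
  [set S | tiles S setT /\
    forall P w, P `<=` S -> is_patch P -> label_word P w -> allowed zeta w].

Definition tiling_space := set_type subst_tilings.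
HB.instance Definition _ := Choice.on tiling_space.

Definition translate_tile (y : R) T : tile := (T.1 - y, T.2).
Definition translate (y : R) P : set tile := translate_tile y @` P.

Definition tiling_base (Pe : set tile * R) : set tiling_space :=
  [set S | exists2 y, -Pe.2 < y < Pe.2 & translate y Pe.1 `<=` val S].

Lemma tile_lt_end T : T.1 < tile_end T.
Proof. by rewrite ltrDl. Qed.

Lemma translate_tileD y z T :
  translate_tile y (translate_tile z T) = translate_tile (y + z) T.
Proof. by rewrite /translate_tile /= opprD addrA addrAC. Qed.

Lemma translateD y z P : translate y (translate z P) = translate (y + z) P.
Proof.
by rewrite /translate image_comp; apply: eq_imagel => T _ /=; exact: translate_tileD.
Qed.

Lemma translate_tile0 T : translate_tile 0 T = T.
Proof. by case: T => x i; rewrite /translate_tile subr0. Qed.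

Lemma translate0 P : translate 0 P = P.
Proof.
by rewrite -[RHS]image_id; apply: eq_imagel => T _; exact: translate_tile0.
Qed.

Lemma translateK y P : translate (- y) (translate y P) = P.
Proof. by rewrite translateD addNr translate0. Qed.

Lemma tile_suppE y T x : tile_supp (translate_tile y T) x = tile_supp T (x + y).
Proof.
by rewrite /tile_supp /tile_end /= !in_itv /= addrAC lerBlDr lerBrDr.
Qed.

Lemma tile_intE y T x : tile_int (translate_tile y T) x = tile_int T (x + y).
Proof.
by rewrite /tile_int /tile_end /= !in_itv /= addrAC ltrBlDr ltrBrDr.
Qed.

Lemma tiles_translate y P I :
  tiles P I -> tiles (translate y P) [set x | I (x + y)].
Proof.
move=> [<- tP]; split.
  apply/seteqP; split=> [x [_ [T PT <-]]|x [T PT]].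
    by rewrite tile_suppE => ?; exists T.
  by rewrite -tile_suppE => ?; exists (translate_tile y T) => //; exists T.
move=> _ _ [T PT <-] [T' PT' <-] [x [xT xT']]; congr translate_tile.
by apply: tP => //; exists (x + y); split; rewrite -tile_intE.
Qed.

Lemma patch_translate y P : is_patch P -> is_patch (translate y P).
Proof.
move=> [c [d [cd PP]]]; exists (c - y), (d - y); split; first by rewrite ltrD2r.
suff -> : `[c - y, d - y]%classic = [set x | `[c, d]%classic (x + y)].
  exact: tiles_translate.
by apply/seteqP; split=> x; rewrite /= !in_itv /= lerBlDr lerBrDr.
Qed.

Lemma label_word_translate y P w :
  label_word P w -> label_word (translate y P) w.
Proof.
move=> [s [ss -> ->]]; exists [seq translate_tile y T | T <- s]; split.
- rewrite sorted_map; apply: sub_sorted ss => T T' /=.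
  by rewrite ltrD2r.
- apply/seteqP; split=> [_ [T /= Ts <-]|T /= /mapP[T' T's ->]]; last by exists T'.
  exact: map_f.
- by rewrite -map_comp.
Qed.

Lemma translate_subproof g (S : tiling_space) :
  translate g (val S) \in subst_tilings.
Proof.
have [tS aS] := set_mem (valP S); rewrite inE; split.
  exact: tiles_translate tS.
move=> P w PS pP wP; apply: (aS (translate (- g) P) w).
- by rewrite -[X in _ `<=` X](translateK g); exact: image_subset.
- exact: patch_translate.
- exact: label_word_translate.
Qed.

(* T_g(S) = S - g *)
Definition tiling_flow (g : R) (S : tiling_space) : tiling_space :=
  exist (fun S' => S' \in subst_tilings) _ (translate_subproof g S).

Lemma tile_overlap S T T' : trivIset S tile_int -> S T -> S T' ->
  T.1 < tile_end T' -> T'.1 < tile_end T -> T = T'.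
Proof.
move=> tS ST ST' TT' T'T; apply: tS => //.
have lt : Num.max T.1 T'.1 < Num.min (tile_end T) (tile_end T').
  by rewrite lt_min !gt_max !tile_lt_end TT' T'T.
have := midf_lt lt; set x := (_ / _) => -[].
rewrite lt_min !gt_max => /andP[? ?] /andP[? ?].
by exists x; split; rewrite /tile_int /= in_itv /=; apply/andP.
Qed.

Lemma tile_in_itv P c d T :
  tiles P `[c, d] -> P T -> c <= T.1 /\ tile_end T <= d.
Proof.
move=> [PE _] PT; have le := ltW (tile_lt_end T).
have s : tile_supp T `<=` `[c, d] by rewrite -PE; exact: bigcup_sup.
have : tile_supp T T.1 by rewrite /tile_supp /= in_itv /= lexx.
have : tile_supp T (tile_end T) by rewrite /tile_supp /= in_itv /= lexx le.
by move=> /s + /s; rewrite /= !in_itv /= => /andP[_ ->] /andP[->].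
Qed.

Lemma patch_ends P c d : c < d -> tiles P `[c, d] ->
  (exists2 A, P A & A.1 = c) /\ (exists2 B, P B & tile_end B = d).
Proof.
move=> cd tP; have sub T := tile_in_itv tP (T := T); have [PE _] := tP.
split.
  have : `[c, d]%classic c by rewrite /= in_itv /= lexx ltW.
  rewrite -PE => -[A PA]; rewrite /tile_supp /= in_itv /= => /andP[Ac _].
  by exists A => //; apply/eqP; rewrite eq_le Ac (sub _ PA).1.
have : `[c, d]%classic d by rewrite /= in_itv /= lexx ltW.
rewrite -PE => -[A PA]; rewrite /tile_supp /= in_itv /= => /andP[_ Ad].
by exists A => //; apply/eqP; rewrite eq_le Ad (sub _ PA).2.
Qed.

Lemma tiling_hull S A B : tiles S setT -> S A -> S B -> A.1 < tile_end B ->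
  tiles [set T | [/\ S T, A.1 <= T.1 & tile_end T <= tile_end B]]
    `[A.1, tile_end B].
Proof.
move=> [SE tS] SA SB AB.
have leA T : S T -> T.1 < A.1 -> tile_end T <= A.1.
  move=> ST TA; rewrite leNgt; apply/negP => AT; move: (TA).
  by rewrite (tile_overlap tS ST SA) ?ltxx // (lt_trans TA) // tile_lt_end.
have geB T : S T -> tile_end B < tile_end T -> tile_end B <= T.1.
  move=> ST BT; rewrite leNgt; apply/negP => TB; move: (BT).
  by rewrite (tile_overlap tS ST SB) ?ltxx // (lt_trans _ BT) // tile_lt_end.
split; last by move=> T T' [ST _ _] [ST' _ _]; exact: tS.
apply/seteqP; split=> x.
  move=> [T [_ AT TB]]; rewrite /tile_supp /= !in_itv /= => /andP[Tx xT].
  by rewrite (le_trans AT) // (le_trans xT).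
rewrite /= in_itv /= => /andP[Ax xB].
have : [set: R] x by []; rewrite -SE => -[T ST].
rewrite /tile_supp /= in_itv /= => /andP[Tx xT].
have [TA|AT] := ltP T.1 A.1.
  have xA : x = A.1 by apply/eqP; rewrite eq_le Ax (le_trans xT) ?leA.
  exists A; last by rewrite /tile_supp /= in_itv /= xA lexx ltW ?tile_lt_end.
  split => //; rewrite leNgt; apply/negP => /(geB _ SA).
  by rewrite leNgt AB.
have [BT|TB] := ltP (tile_end B) (tile_end T).
  have xE : x = tile_end B.
    by apply/eqP; rewrite eq_le xB (le_trans (geB _ ST BT)).
  exists B; last by rewrite /tile_supp /= in_itv /= xE lexx ltW ?tile_lt_end.
  split => //; rewrite leNgt; apply/negP => /(leA _ SB).
  by rewrite leNgt AB.
by exists T => //; rewrite /tile_supp /= in_itv /= Tx.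
Qed.

Lemma patch_join S P Q : tiles S setT -> is_patch P -> is_patch Q ->
  P `<=` S -> Q `<=` S -> exists P', [/\ is_patch P', P' `<=` S & P `|` Q `<=` P'].
Proof.
move=> tS [c [d [cd tP]]] [c' [d' [cd' tQ]]] PS QS.
have [[A PA Ac] [B PB Bd]] := patch_ends cd tP.
have [[A' QA Ac'] [B' QB Bd']] := patch_ends cd' tQ.
have [E [SE Ec Ec']] : exists E, [/\ S E, E.1 <= c & E.1 <= c'].
  have [cc|cc] := leP c c'; [exists A | exists A']; split=> //;
    rewrite ?Ac ?Ac' //; [exact: PS | exact: QS | exact: ltW].
have [F [SF Fd Fd']] : exists F, [/\ S F, d <= tile_end F & d' <= tile_end F].
  have [dd|dd] := leP d d'; [exists B' | exists B]; split=> //;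
    rewrite ?Bd ?Bd' //; [exact: QS | exact: PS | exact: ltW].
exists [set T | [/\ S T, E.1 <= T.1 & tile_end T <= tile_end F]]; split.
- have EF : E.1 < tile_end F by rewrite (le_lt_trans Ec) // (lt_le_trans cd).
  by exists E.1, (tile_end F); split => //; exact: tiling_hull.
- by move=> T [].
- move=> T [PT|QT].
    have [? ?] := tile_in_itv tP PT; split; [exact: PS|exact: le_trans Ec _|].
    exact: le_trans Fd.
  have [? ?] := tile_in_itv tQ QT; split; [exact: QS|exact: le_trans Ec' _|].
  exact: le_trans Fd'.
Qed.

Let base_dom : set (set tile * R) := [set Pe | is_patch Pe.1 /\ 0 < Pe.2].

Let tiling_base_cover : \bigcup_(Pe in base_dom) tiling_base Pe = setT.
Proof.
apply/seteqP; split=> // S _; have [[SE tS] _] := set_mem (valP S).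
have : [set: R] 0 by []; rewrite -SE => -[T ST _].
exists ([set T], 1).
  split => //=; exists T.1, (tile_end T); split; first exact: tile_lt_end.
  by split; [rewrite bigcup_set1 | move=> _ _ -> ->].
exists 0; first by rewrite /= ltrN10 ltr01.
by rewrite translate0 => _ ->.
Qed.

Let tiling_base_join (Pe Qd : set tile * R) (S : tiling_space) :
  base_dom Pe -> base_dom Qd -> tiling_base Pe S -> tiling_base Qd S ->
  exists Pe', [/\ base_dom Pe', tiling_base Pe' S &
    tiling_base Pe' `<=` tiling_base Pe `&` tiling_base Qd].
Proof.
case: Pe Qd => [P e] [Q d] [/= pP e0] [/= pQ d0] [y /= ye PS] [z /= zd QS].
have [tS _] := set_mem (valP S).
have [P' [pP' P'S PQ]] := patch_join tS (patch_translate y pP)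
  (patch_translate z pQ) PS QS.
have y0 : 0 < e - `|y| by rewrite subr_gt0 ltr_norml.
have z0 : 0 < d - `|z| by rewrite subr_gt0 ltr_norml.
have m0 : 0 < Num.min (e - `|y|) (d - `|z|) by rewrite lt_min y0.
exists (P', Num.min (e - `|y|) (d - `|z|)); split => //.
  by exists 0; rewrite /= ?oppr_lt0 ?m0 // translate0.
move=> S' [w /=]; rewrite -ltr_norml lt_min => /andP[we wd] wP'; split.
  exists (w + y) => /=.
    by rewrite -ltr_norml (le_lt_trans (ler_normD _ _)) // -ltrBrDr.
  rewrite -translateD; apply: subset_trans wP'; apply: image_subset.
  by move=> T PT; apply: PQ; left.
exists (w + z) => /=.
  by rewrite -ltr_norml (le_lt_trans (ler_normD _ _)) // -ltrBrDr.
rewrite -translateD; apply: subset_trans wP'; apply: image_subset.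
by move=> T QT; apply: PQ; right.
Qed.

(* The topology with basis the sets X_(P,e), for P a patch and e > 0. *)
HB.instance Definition _ := isBaseTopological.Build tiling_space
  tiling_base_cover tiling_base_join.

End Tilings.

Arguments tiling_flow {R m} t zeta g S.

(* Main.v *)
(* Counting zeros in sliding windows of length n, every p with
   a(n) <= p < b(n) is the number of zeros of an allowed word W of length n
   that begins with 1 and is followed by 0.  If b(n) - a(n) tends to infinity,
   the pairs (p, n - p) fill an unboundedly wide strip, so the lengths
   p |zeta^k(0)| + (n - p) |zeta^k(1)| of zeta^k(W) hit every large integer when
   the two lengths are coprime, and come arbitrarily close to every large real
   when the two tile lengths are incommensurable.  As zeta^k(1) and zeta^k(0)
   contain any two given allowed words u and v, this gives mixing.

   Conversely, suppose the system is mixing and b(n) - a(n) <= K for infinitely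
   many n.  Placing v exactly n letters after u, for such n, and comparing the
   windows of length n starting at the two ends of u bounds the difference of
   the numbers of zeros of v and u by K; so b - a <= K everywhere.  Then, for
   the frequency alpha of 0, the discrepancy D(w) = #zeros(w) - alpha |w| is
   bounded.  If |D(w)| nearly attains its supremum, then the discrepancy between
   any two disjoint occurrences of w nearly vanishes, so alpha |W| is nearly an
   integer for every word W separating two such occurrences.  By mixing these
   |W| take all large values, which contradicts 0 < alpha < 1; for tilings, the
   distances between such occurrences are nearly multiples of
   alpha t_0 + (1 - alpha) t_1. *)
Require Import Defs.
From mathcomp Require Import all_boot all_order all_algebra.
From mathcomp Require Import all_classical all_reals all_analysis.
From mathcomp Require Import zify ring lra.

Set Implicit Arguments.
Unset Strict Implicit.
Unset Printing Implicit Defensive.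

Local Open Scope classical_set_scope.
Local Open Scope ring_scope.

Import Order.TTheory GRing.Theory Num.Theory.
Import numFieldNormedType.Exports.

(** * Words and their images *)

(** * Words and their images *)

Section Windows.
Variables (m : nat) (zeta : substitution m).
Implicit Types (x : biseq m) (u v w : seq 'I_m) (i : 'I_m).

Lemma size_window x j n : size (window x j n) = n.
Proof. by rewrite size_mkseq. Qed.

Lemma nth_window d x j n k : (k < n)%N -> nth d (window x j n) k = x (j + k%:Z).
Proof. by move=> kn; rewrite nth_mkseq. Qed.

Lemma window_cat x j n k :
  window x j (n + k) = window x j n ++ window x (j + n%:Z) k.
Proof.
rewrite /window /mkseq iotaD map_cat add0n; congr cat.
have -> : iota n k = map (addn n) (iota 0 k) by rewrite -iotaDl addn0.
by rewrite -map_comp; apply: eq_map => l /=; rewrite PoszD addrA.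
Qed.

Lemma window1 x j : window x j 1 = [:: x j].
Proof. by rewrite /window /mkseq /= addr0. Qed.

Lemma window_translate g x j n :
  window (translate_seq g x) j n = window x (j + g) n.
Proof. by apply: eq_mkseq => k; rewrite /translate_seq addrAC. Qed.

Lemma subst_seqs_translate g x :
  subst_seqs zeta x -> subst_seqs zeta (translate_seq g x).
Proof. by move=> xX j n i; rewrite window_translate; exact: xX. Qed.

Lemma allowed_window x j n : subst_seqs zeta x -> allowed zeta (window x j n).
Proof. by move=> xX; exists x => //; exists j; rewrite size_window. Qed.

Lemma allowed_at0 w : allowed zeta w ->
  exists2 x, subst_seqs zeta x & window x 0 (size w) = w.
Proof.
move=> [x xX [j jw]]; exists (translate_seq j x); first exact: subst_seqs_translate.
by rewrite window_translate add0r.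
Qed.

Lemma subst_word_cat u v :
  subst_word zeta (u ++ v) = subst_word zeta u ++ subst_word zeta v.
Proof. by rewrite /subst_word map_cat flatten_cat. Qed.

Lemma iter_subst_cat k u v : iter k (subst_word zeta) (u ++ v) =
  iter k (subst_word zeta) u ++ iter k (subst_word zeta) v.
Proof. by elim: k => //= k ->; rewrite subst_word_cat. Qed.

Lemma iter_subst_nil k : iter k (subst_word zeta) [::] = [::].
Proof. by elim: k => //= k ->. Qed.

Lemma subst_iterS k i : subst_iter zeta k.+1 i = subst_word zeta (subst_iter zeta k i).
Proof. by []. Qed.

Lemma size_subst_word w : (size w <= size (subst_word zeta w))%N.
Proof.
elim: w => //= i w IH; rewrite -cat1s subst_word_cat size_cat.
have : (0 < size (subst_word zeta [:: i]))%N.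
  by rewrite /subst_word /= cats0 lt0n size_eq0 subst_neq_nil.
lia.
Qed.

Lemma subst_iter_gt0 k i : (0 < size (subst_iter zeta k i))%N.
Proof. by elim: k => //= k IH; exact: leq_trans (size_subst_word _). Qed.

Lemma infix_subst_word u v :
  infix u v -> infix (subst_word zeta u) (subst_word zeta v).
Proof.
by move=> /infixP[s [s' ->]]; rewrite !subst_word_cat infix_infix.
Qed.

(* zeta(x), with the image of [x 0] starting at 0.  Images are at least as long
   as their words, so the image of [n.+1] letters has an [n]-th letter. *)
Definition subst_biseq (x : biseq m) : biseq m := fun j =>
  match j with
  | Posz n => nth (x 0) (subst_word zeta (window x 0 n.+1)) n
  | Negz n => nth (x 0) (rev (subst_word zeta (window x (Negz n) n.+1))) n
  end.

Lemma subst_biseq_pos x N n : (n < size (subst_word zeta (window x 0 N)))%N ->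
  subst_biseq x n%:Z = nth (x 0) (subst_word zeta (window x 0 N)) n.
Proof.
move=> nN; rewrite /subst_biseq.
(* Lengthening the window only appends letters to its image, so the letter at [n] does not depend on
   the window used. *)
have aux a b : (a <= b)%N -> (n < size (subst_word zeta (window x 0 a)))%N ->
    nth (x 0) (subst_word zeta (window x 0 b)) n =
    nth (x 0) (subst_word zeta (window x 0 a)) n.
  by move=> /subnKC <- na; rewrite window_cat subst_word_cat nth_cat na.
have [le|/ltnW le] := leqP n.+1 N; last by rewrite (aux _ _ le).
by rewrite (aux _ _ le)//; apply: leq_trans (size_subst_word _); rewrite size_window.
Qed.

Lemma subst_biseq_neg x N n :
  (n < size (subst_word zeta (window x (- N%:Z) N)))%N ->
  subst_biseq x (- (n.+1)%:Z) =
    nth (x 0) (rev (subst_word zeta (window x (- N%:Z) N))) n.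
Proof.
move=> nN; rewrite -NegzE /subst_biseq NegzE.
have aux a b : (a <= b)%N ->
    (n < size (subst_word zeta (window x (- a%:Z) a)))%N ->
    nth (x 0) (rev (subst_word zeta (window x (- b%:Z) b))) n =
    nth (x 0) (rev (subst_word zeta (window x (- a%:Z) a))) n.
  move=> /subnKC <- na; rewrite [in LHS](addnC a) window_cat subst_word_cat rev_cat.
  rewrite nth_cat size_rev.
  have -> : - (b - a + a)%N%:Z + (b - a)%N%:Z = - a%:Z by lia.
  by rewrite na.
have [le|/ltnW le] := leqP n.+1 N; last by rewrite (aux _ _ le).
by rewrite (aux _ _ le)//; apply: leq_trans (size_subst_word _); rewrite size_window.
Qed.

Lemma subst_biseq_window0 x n :
  window (subst_biseq x) 0 (size (subst_word zeta (window x 0 n))) =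
  subst_word zeta (window x 0 n).
Proof.
apply: (@eq_from_nth _ (x 0)); rewrite size_window// => k kn.
by rewrite nth_window// add0r (subst_biseq_pos kn).
Qed.

Lemma subst_biseq_window x n n' :
  window (subst_biseq x) (- (size (subst_word zeta (window x (- n%:Z) n)))%:Z)
    (size (subst_word zeta (window x (- n%:Z) (n + n')))) =
  subst_word zeta (window x (- n%:Z) (n + n')).
Proof.
rewrite window_cat subst_word_cat size_cat window_cat addNr addNr.
rewrite subst_biseq_window0; congr cat.
apply: (@eq_from_nth _ (x 0)); rewrite size_window// => k kn.
rewrite nth_window//; set L := size _ in kn *.
(* To the left of 0 the letters are read backwards, from the reversed image. *)
have -> : - L%:Z + k%:Z = - ((L - k.+1).+1)%:Z by lia.
rewrite (@subst_biseq_neg _ n) -/L; last lia.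
by rewrite nth_rev -/L; [congr nth; lia | lia].
Qed.

(** Images are at least as long as their words, so the window at [j] of length [n] lies in the image
    of the central window of [x] of radius [absz j + n]. When the latter occurs in [zeta^k(i)], its
    image occurs in [zeta^(k+1)(i)]. *)
Lemma subst_seqs_subst x : subst_seqs zeta x -> subst_seqs zeta (subst_biseq x).
Proof.
move=> xX j n i; pose N := (absz j + n)%N.
have [K _ HK] := xX (- N%:Z) (N + N)%N i.
exists K.+1 => // -[//|k] /= Kk.
have /infix_subst_word := HK k Kk; rewrite -subst_iterS; apply: infix_trans.
rewrite -subst_biseq_window.
set L := size (subst_word _ (window x _ N)).
set M := size _.
have NL : (N <= L)%N.
  by apply: leq_trans (size_subst_word _); rewrite size_window.
have NM : (L + N <= M)%N.
  rewrite /M window_cat subst_word_cat size_cat -/L leq_add2l.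
  by apply: leq_trans (size_subst_word _); rewrite size_window.
have [a ja aM] : exists2 a : nat, j = - L%:Z + a%:Z & (a + n <= M)%N.
  by exists (absz (j + L%:Z)); rewrite /N in NL NM *; lia.
rewrite ja -(subnKC aM) -addnA.
by rewrite window_cat window_cat infix_infix.
Qed.

Lemma allowed_subst w : allowed zeta w -> allowed zeta (subst_word zeta w).
Proof.
move=> /allowed_at0[x xX xw]; exists (subst_biseq x); first exact: subst_seqs_subst.
by exists 0; have := subst_biseq_window0 x (size w); rewrite xw.
Qed.

Lemma allowed_iter_subst k w :
  allowed zeta w -> allowed zeta (iter k (subst_word zeta) w).
Proof. by elim: k => //= k IH /IH /allowed_subst. Qed.

Lemma window_infix u v w x j : window x j (size (u ++ v ++ w)) = u ++ v ++ w ->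
  window x (j + (size u)%:Z) (size v) = v.
Proof.
rewrite !size_cat !window_cat => /eqP.
by rewrite eqseq_cat ?size_window// eqseq_cat ?size_window// => /and3P[_ /eqP].
Qed.

Lemma allowed_infix u v : infix u v -> allowed zeta v -> allowed zeta u.
Proof.
move=> /infixP[s [s' ->]] [x xX [j /window_infix jw]].
by exists x => //; exists (j + (size s)%:Z).
Qed.

(** The alphabet is finite, so the largest of the thresholds serves all letters. *)
Lemma allowed_infix_iter w : allowed zeta w ->
  exists K, forall k i, (K <= k)%N -> infix w (subst_iter zeta k i).
Proof.
move=> [x xX [j <-]].
have /boolp.choice[K HK] : forall i, exists K, forall k, (K <= k)%N ->
    infix (window x j (size w)) (subst_iter zeta k i).
  by move=> i; have [K _ HK] := xX j (size w) i; exists K.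
exists (\max_i K i)%N => k i le; apply: HK; apply: leq_trans le.
exact: leq_bigmax.
Qed.

End Windows.

(** * Counts of a letter in windows *)

Section Counts.
Variables (m : nat) (zeta : substitution m) (i : 'I_m).
Implicit Types (x : biseq m) (u v w : seq 'I_m).
Local Notation X := (subst_seqs zeta).

Lemma min_count_le_window x j n : X x ->
  (min_count zeta i n <= count_mem i (window x j n))%N.
Proof.
move=> xX; rewrite /min_count.
have tw : size (window x j n) == n by rewrite size_window.
have : Tuple tw \in index_enum (n.-tuple 'I_m) by rewrite mem_index_enum.
(* [minn] has no neutral element, so the bound is proved along the enumeration of the tuples. *)
elim: (index_enum _) => // t r IH; rewrite in_cons big_cons => /orP[/eqP <-|/IH {}IH].
  by rewrite asboolT ?geq_minl//; exact: allowed_window.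
by case: ifP => // _; rewrite geq_min IH orbT.
Qed.

Lemma max_count_ge_window x j n : X x ->
  (count_mem i (window x j n) <= max_count zeta i n)%N.
Proof.
move=> xX; have tw : size (window x j n) == n by rewrite size_window.
have := @leq_bigmax_cond _ (fun w : n.-tuple 'I_m => `[< allowed zeta w >])
  (fun w : n.-tuple 'I_m => count_mem i w) (Tuple tw).
by apply; rewrite asboolT//; exact: allowed_window.
Qed.

Hypothesis X_neq0 : X !=set0.

Lemma min_count_window n : exists2 x, X x &
  exists j, count_mem i (window x j n) = min_count zeta i n.
Proof.
have [x0 x0X] := X_neq0.
suff : min_count zeta i n = n \/ exists2 x, X x &
    exists j, count_mem i (window x j n) = min_count zeta i n.
  (* If the minimum is the default value [n], every window attains it, since no count exceeds
     [n]. *)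
  case=> // en; exists x0 => //; exists 0; apply/eqP; rewrite eqn_leq.
  rewrite min_count_le_window// andbT en -[leqRHS](size_window x0 0 n).
  exact: count_size.
apply: (big_ind (fun c => c = n \/ exists2 x, X x &
    exists j, count_mem i (window x j n) = c)); first by left.
  by move=> a b Ha Hb; rewrite /minn; case: ifP.
move=> w /asboolP[x xX [j xw]]; right; exists x => //; exists j.
by rewrite -[in RHS]xw size_tuple.
Qed.

Lemma max_count_window n : exists2 x, X x &
  exists j, count_mem i (window x j n) = max_count zeta i n.
Proof.
have [x0 x0X] := X_neq0.
suff : max_count zeta i n = 0%N \/ exists2 x, X x &
    exists j, count_mem i (window x j n) = max_count zeta i n.
  case=> // en; exists x0 => //; exists 0; apply/eqP; rewrite eqn_leq.
  by rewrite max_count_ge_window// en.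
apply: (big_ind (fun c => c = 0%N \/ exists2 x, X x &
    exists j, count_mem i (window x j n) = c)); first by left.
  by move=> a b Ha Hb; rewrite /maxn; case: ifP.
move=> w /asboolP[x xX [j xw]]; right; exists x => //; exists j.
by rewrite -[in RHS]xw size_tuple.
Qed.

Lemma count_windowS x j n :
  count_mem i (window x j n.+1) = (count_mem i (window x j n) + (x (j + n%:Z)%R == i))%N.
Proof. by rewrite -addn1 window_cat count_cat window1 /= addn0. Qed.

Lemma count_window_slide x j n :
  ((x j == i) + count_mem i (window x (j + 1)%R n) =
   count_mem i (window x j n) + (x (j + n%:Z)%R == i))%N.
Proof.
by rewrite -count_windowS -add1n window_cat count_cat window1 /= addn0.
Qed.

Lemma min_count0 : min_count zeta i 0 = 0%N.
Proof. by have [x _ [j <-]] := min_count_window 0. Qed.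

Lemma max_count0 : max_count zeta i 0 = 0%N.
Proof. by have [x _ [j <-]] := max_count_window 0. Qed.

(** One inequality comes from shortening an optimal window by a letter, the other from lengthening
    one. *)
Lemma min_countS n :
  (min_count zeta i n <= min_count zeta i n.+1 <= (min_count zeta i n).+1)%N.
Proof.
apply/andP; split.
  have [x xX [j <-]] := min_count_window n.+1.
  by rewrite count_windowS (leq_trans (min_count_le_window j n xX))// leq_addr.
have [x xX [j <-]] := min_count_window n.
rewrite (leq_trans (min_count_le_window j n.+1 xX))// count_windowS -addn1 leq_add2l.
by case: (_ == _).
Qed.

Lemma max_countS n :
  (max_count zeta i n <= max_count zeta i n.+1 <= (max_count zeta i n).+1)%N.
Proof.
apply/andP; split.
  have [x xX [j <-]] := max_count_window n.
  by rewrite (leq_trans _ (max_count_ge_window j n.+1 xX))// count_windowS leq_addr.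
have [x xX [j <-]] := max_count_window n.+1.
rewrite count_windowS -addn1 leq_add// ?max_count_ge_window//.
by case: (_ == _).
Qed.

(** For large [k], [u] occurs in [zeta^k] of the first letter of a two-letter allowed word and [v]
    in [zeta^k] of the second, so the image of that word contains both, in this order. *)
Lemma allowed_pair u v : allowed zeta u -> allowed zeta v ->
  exists2 x, X x & exists d, window x 0 (size u) = u /\ window x d%:Z (size v) = v.
Proof.
move=> /allowed_infix_iter[K HK] /allowed_infix_iter[L HL].
have [x0 x0X] := X_neq0.
have := allowed_iter_subst (maxn K L) (allowed_window 0 2 x0X).
rewrite -addn1 window_cat !window1 iter_subst_cat -!/(subst_iter _ _ _).
have /infixP[s [s' ->]] := HK (maxn K L) (x0 0) (leq_maxl _ _).
have /infixP[r [r' ->]] := HL (maxn K L) (x0 (0 + 1%:Z)) (leq_maxr _ _).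
move=> /allowed_at0[x xX xw].
exists (translate_seq (size s)%:Z x); first exact: subst_seqs_translate.
exists (size u + size s' + size r)%N; rewrite !window_translate; split.
  by move: xw; rewrite -!catA => /window_infix; rewrite addrC.
move: xw; have -> : (s ++ u ++ s') ++ r ++ v ++ r' = (s ++ u ++ s' ++ r) ++ v ++ r'.
  by rewrite -!catA.
move=> /window_infix; rewrite !size_cat => {2}<-; congr window; rewrite -?addnA !PoszD; ring.
Qed.

(* Slide a window from a place where it has the minimal count to a later place
   where it has the maximal one, and stop just before the count exceeds [p]. *)
Lemma count_increase n p : (min_count zeta i n <= p < max_count zeta i n)%N ->
  exists2 x, X x & [/\ count_mem i (window x 0 n) = p, x 0 != i & x n%:Z = i].
Proof.
move=> /andP[ap pb].
have [y yX [j yj]] := min_count_window n.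
have [z zX [l zl]] := max_count_window n.
have [x xX [d []]] := allowed_pair (allowed_window j n yX) (allowed_window l n zX).
rewrite !size_window => x0 xd.
have ex : exists d : nat, (p < count_mem i (window x d%:Z n))%N.
  by exists d; rewrite xd zl.
case: (ex_minnP ex) => -[|e] pe emin; first by move: pe; rewrite x0 yj ltnNge ap.
have {}emin : (count_mem i (window x e%:Z n) <= p)%N.
  by rewrite leqNgt; apply/negP => /emin; rewrite ltnn.
exists (translate_seq e%:Z x); first exact: subst_seqs_translate.
have := count_window_slide x e%:Z n.
rewrite -[e%:Z + 1]PoszD addn1 window_translate /translate_seq !add0r [n%:Z + _]addrC.
move: pe emin; case: (x e%:Z == i); case: (x (e%:Z + n%:Z) =P i) => //= Hx;
  move=> H1 H2 H3; try (by exfalso; lia).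
by split=> //; lia.
Qed.

End Counts.

(** * Integer combinations of two lengths *)

Section Arithmetic.
Variable R : realType.
Implicit Types (l d g r : R).

Lemma floor_bounds (x : R) : (Num.floor x)%:~R <= x < (Num.floor x)%:~R + 1.
Proof. by have := real_floor_itv (num_real x); rewrite intrD. Qed.

(* The bound [C] on the coefficients is uniform in [r]. *)
Definition approximable (l0 l1 d : R) := forall M : R, exists C : nat,
  forall r, 0 <= r <= M -> exists u v : int,
    [/\ (absz u <= C)%N, (absz v <= C)%N & `|u%:~R * l0 + v%:~R * l1 - r| < d].

(** Round [r] down to a multiple of [y]. The error is less than [y], and the multiplier is at most
    the one for [M], whence the uniform bound. *)
Lemma approximable_small l0 l1 d (y : R) (u v : int) :
  y = u%:~R * l0 + v%:~R * l1 -> 0 < y -> y <= d -> approximable l0 l1 d.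
Proof.
move=> yE y0 yd M.
exists ((absz (Num.floor (M / y)) + 1) * (absz u + absz v))%N.
move=> r /andP[r0 rM]; pose j := Num.floor (r / y).
have j0 : 0 <= j by rewrite floor_ge0 divr_ge0// ltW.
have jM : j <= Num.floor (M / y) by apply: le_floor; rewrite ler_pM2r ?invr_gt0.
have jC : (absz j <= absz (Num.floor (M / y)) + 1)%N by lia.
exists (j * u), (j * v); split.
- by rewrite abszM leq_mul// leq_addr.
- by rewrite abszM leq_mul// leq_addl.
rewrite !intrM -!mulrA -mulrDr -yE.
have /andP[] := floor_bounds (r / y).
rewrite -/j ler_pdivlMr// ltr_pdivrMr// => h1 h2.
rewrite ltr_norml; move: h2; rewrite mulrDl mul1r => h2.
by apply/andP; split; lra.
Qed.

Lemma approximable_coprime (l0 l1 : nat) :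
  coprime l0 l1 -> approximable l0%:R l1%:R 1.
Proof.
move=> co; have [u [v]] := Bezoutz l0%:Z l1%:Z.
rewrite /gcdz /= (eqP co) => uv.
apply: (@approximable_small _ _ _ 1 u v); rewrite ?ltr01 ?lexx//.
by rewrite !pmulrn -!intrM -intrD uv.
Qed.

(** If all positive integer combinations exceeded [d], they would have a least element [s], and [l0]
    and [l1] would both be multiples of [s], against independence. *)
Lemma approximable_independent l0 l1 d : 0 < l0 -> 0 < d ->
  (forall u v : int, u%:~R * l0 + v%:~R * l1 = 0 -> u = 0 /\ v = 0) ->
  approximable l0 l1 d.
Proof.
move=> l00 d0 indep.
pose S := [set y : R | 0 < y /\ exists u v : int, y = u%:~R * l0 + v%:~R * l1].
have [[y [y0 [u [v yE]]] yd]|nS] := pselect (exists2 y, S y & y <= d).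
  exact: (approximable_small yE).
have Sd y : S y -> d < y.
  by move=> Sy; rewrite ltNge; apply/negP => yd; apply: nS; exists y.
have Sl0 : S l0 by split=> //; exists 1, 0; rewrite mul1r mul0r addr0.
have iS : has_inf S by split; [exists l0|exists d => y /Sd /ltW].
have SB y z : S y -> S z -> z < y -> S (y - z).
  move=> [_ [u [v ->]]] [_ [u' [v' ->]]] zy; split; first by rewrite subr_gt0.
  by exists (u - u'), (v - v'); rewrite !intrB; ring.
pose s := inf S.
have sS y : S y -> s <= y by move=> Sy; apply: ge_inf Sy; case: iS.
have s0 : 0 < s by apply: lt_le_trans d0 _; apply: lb_le_inf; [exists l0 | move=> y /Sd /ltW].
(* Otherwise two distinct combinations lie strictly between [s] and [2 s], and their difference is a
   positive combination below [s]. *)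
have Ss : S s.
  have [y Sy ys] := inf_adherent s0 iS.
  have [e|ne] := eqVneq y s; first by rewrite -e.
  have sy : 0 < y - s by rewrite subr_gt0 lt_neqAle eq_sym ne sS.
  have [z Sz zs] := inf_adherent sy iS.
  have zy : z < y by rewrite (lt_le_trans zs)// -/s; lra.
  have /sS := SB _ _ Sy Sz zy; have := sS _ Sz.
  by rewrite -/s in ys zs *; lra.
have [_ [u [v sE]]] := Ss.
have mult h : (exists a b : int, h = a%:~R * l0 + b%:~R * l1) ->
    exists k : int, h = k%:~R * s.
  move=> [a [b hE]]; exists (Num.floor (h / s)); set k := Num.floor _.
  have /andP[] := floor_bounds (h / s).
  rewrite -/k ler_pdivlMr// ltr_pdivrMr// mulrDl mul1r => h1 h2.
  apply/eqP; rewrite eq_le h1 andbT leNgt; apply/negP => h3.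
  suff : S (h - k%:~R * s) by move/sS; lra.
  split; first by rewrite subr_gt0.
  by exists (a - k * u), (b - k * v); rewrite !intrB !intrM hE sE; ring.
have [m mE] : exists k : int, l0 = k%:~R * s.
  by apply: mult; exists 1, 0; rewrite mul1r mul0r addr0.
have [n nE] : exists k : int, l1 = k%:~R * s.
  by apply: mult; exists 0, 1; rewrite mul1r mul0r add0r.
(* Substituting [s = u l0 + v l1] in [l0 = m s] and [l1 = n s] gives [m u = 1], [m v = 0], [n u = 0]
   and [n v = 1], which is impossible. *)
have /indep[e1 e2] : (m * u - 1)%:~R * l0 + (m * v)%:~R * l1 = 0.
  by rewrite intrB !intrM; rewrite sE in mE; lra.
have /indep[e3 e4] : (n * u)%:~R * l0 + (n * v - 1)%:~R * l1 = 0.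
  by rewrite intrB !intrM; rewrite sE in nE; lra.
nia.
Qed.

Lemma unit_step_le (c : nat -> nat) : (forall n, c n <= c n.+1 <= (c n).+1)%N ->
  forall k l : nat, (k <= l)%N -> (c k <= c l <= c k + (l - k))%N.
Proof.
move=> cS k l /subnKC <-; elim: (l - k)%N => {l}[|l]; first by rewrite addn0; lia.
by rewrite addnS; have := cS (k + l)%N; clear; lia.
Qed.

(** The middle of the strip at [n] is within [2 * C] of its middle at [n'], and [u] moves it by at
    most [C] more, while the half-width at [n'] is at least [3 * C + 5]. *)
Lemma strip_center (a b : nat -> nat) (C N n : nat) (u v : int) :
  a 0%N = 0%N -> b 0%N = 0%N ->
  (forall n, a n <= a n.+1 <= (a n).+1)%N ->
  (forall n, b n <= b n.+1 <= (b n).+1)%N ->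
  (forall n, N <= n -> 6 * C + 10 <= b n - a n)%N ->
  (N + 2 * C <= n)%N -> (absz u <= C)%N -> (absz v <= C)%N ->
  exists n' p : nat, [/\ n'%:Z = n%:Z + u + v, p%:Z = ((a n + b n)./2)%:Z + u
    & (a n' <= p < b n')%N].
Proof.
move=> a0 b0 /unit_step_le aS /unit_step_le bS HN nN uC vC.
pose n' := absz (n%:Z + u + v).
have n'E : n'%:Z = n%:Z + u + v by rewrite /n'; lia.
have n'N : (N <= n')%N by lia.
have abn' := HN _ n'N.
have [an bn] : (a n <= n /\ b n <= n)%N.
  by have := aS 0%N n isT; have := bS 0%N n isT; rewrite a0 b0; lia.
have near : (a n' <= a n + 2 * C /\ a n <= a n' + 2 * C /\
  b n' <= b n + 2 * C /\ b n <= b n' + 2 * C)%N.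
  have [le|/ltnW le] := leqP n n'.
    by have := aS _ _ le; have := bS _ _ le; clear -le n'E uC vC; lia.
  by have := aS _ _ le; have := bS _ _ le; clear -le n'E uC vC; lia.
exists n', (absz (((a n + b n)./2)%:Z + u)).
move: (a n) (b n) (a n') (b n') an bn abn' near; clear -n'E uC vC nN; split; lia.
Qed.

(* Follow the middle line of the strip up to length [g], then correct by a bounded
   integer vector, which does not leave the strip. *)
Lemma strip_hits (a b : nat -> nat) l0 l1 d : 0 < l0 -> 0 < l1 ->
  a 0%N = 0%N -> b 0%N = 0%N ->
  (forall n, a n <= a n.+1 <= (a n).+1)%N ->
  (forall n, b n <= b n.+1 <= (b n).+1)%N ->
  (forall A, exists N, forall n, (N <= n)%N -> (A <= b n - a n)%N) ->
  approximable l0 l1 d ->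
  exists r, forall g, r <= g -> exists n p,
    (a n <= p < b n)%N /\ `|p%:R * l0 + (n%:R - p%:R) * l1 - g| < d.
Proof.
move=> l00 l10 a0 b0 aS bS ab apx.
pose c n := (a n + b n)./2.
pose G n := (c n)%:R * l0 + (n%:R - (c n)%:R) * l1 : R.
have cS n : (c n <= c n.+1 <= (c n).+1)%N.
  by rewrite /c; have := aS n; have := bS n; lia.
pose M := Num.max l0 l1; pose e := Num.min l0 l1.
have [M0 M1] : l0 <= M /\ l1 <= M by rewrite !le_max !lexx orbT.
have [e0 e1] : e <= l0 /\ e <= l1 by rewrite !ge_min !lexx orbT.
have e00 : 0 < e by rewrite lt_min l00.
have GS n : e <= G n.+1 - G n <= M.
  have cE : c n.+1 = c n \/ c n.+1 = (c n).+1 by have := cS n; lia.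
  by rewrite /G; case: cE => ->; rewrite -!natr1; apply/andP; split; nra.
have G0 : G 0%N = 0 by rewrite /G /c a0 b0 /= mul0r subrr mul0r addr0.
have Ge n : n%:R * e <= G n <= n%:R * M.
  elim: n => [|n IH]; first by rewrite G0 !mul0r lexx.
  by have := GS n; rewrite -natr1; lra.
have [C HC] := apx M.
have [N HN] := ab (6 * C + 10)%N.
(* Each step of [G] is at most [M], so beyond this bound the index [n] with [G n <= g < G n.+1] is
   at least [N + 2 * C]. *)
exists ((N + 2 * C).+1%:R * M) => g gR.
have M00 : 0 < M by lra.
have g0 : 0 <= g by apply: le_trans gR; rewrite mulr_ge0 ?ltW.
have ex : exists n, g < G n.+1.
  exists (absz (Num.floor (g / e))).
  have /andP[_] := floor_bounds (g / e).
  rewrite ltr_pdivrMr// => /lt_le_trans; apply; apply: le_trans (proj1 (andP (Ge _))).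
  rewrite ler_pM2r// -natr1 pmulrn gez0_abs// floor_ge0.
  by rewrite divr_ge0// ltW.
have [n gn nmin] := ex_minnP ex.
have Gn : G n <= g.
  case: n gn nmin => [|n] gn nmin; first by rewrite G0.
  by rewrite leNgt; apply/negP => /nmin; rewrite ltnn.
have nN : (N + 2 * C <= n)%N.
  apply: ltnW; rewrite -ltnS -(ltr_nat R) -(ltr_pM2r M00).
  by apply: le_lt_trans gR _; apply: lt_le_trans gn _; case/andP: (Ge n.+1).
have [|u [v [uC vC uv]]] := HC (g - G n); first by have := GS n; lra.
have [n' [p [n'E pE pab]]] := strip_center a0 b0 aS bS HN nN uC vC.
exists n', p; split; first exact: pab.
have -> : p%:R = (c n)%:R + u%:~R :> R by rewrite !pmulrn -intrD pE.
have -> : n'%:R = n%:R + u%:~R + v%:~R :> R by rewrite !pmulrn -!intrD n'E.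
rewrite [X in `|X|](_ : _ = u%:~R * l0 + v%:~R * l1 - (g - G n))// /G; ring.
Qed.

End Arithmetic.

(** * Mixing in terms of words *)

Section Lengths.
Variables (R : realType) (m : nat) (t : 'I_m -> R).
Implicit Types (u v w : seq 'I_m).

(** Constant lengths 1 give the shift, prototile lengths give the tiling flow, and lengths of
    inflated letters give the lengths of inflated words. *)
Definition tlen w : R := \sum_(i <- w) t i.

Lemma tlen_cat u v : tlen (u ++ v) = tlen u + tlen v.
Proof. exact: big_cat. Qed.

Lemma tlen_ge0 w : (forall i, 0 <= t i) -> 0 <= tlen w.
Proof. by move=> t0; apply: sumr_ge0. Qed.

Lemma tlen_gt0 w : (forall i, 0 < t i) -> (0 < size w)%N -> 0 < tlen w.
Proof.
case: w => // i w t0 _; rewrite /tlen big_cons ltr_wpDr// tlen_ge0// => j.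
exact: ltW.
Qed.

Lemma tlen_le_size M w : (forall i, t i <= M) -> tlen w <= (size w)%:R * M.
Proof.
move=> tM; elim: w => [|i w IH]; first by rewrite /tlen big_nil mul0r.
by rewrite /tlen big_cons /= -natr1 mulrDl mul1r addrC lerD.
Qed.

Lemma tlen_ge_size M w : (forall i, M <= t i) -> (size w)%:R * M <= tlen w.
Proof.
move=> tM; elim: w => [|i w IH]; first by rewrite /tlen big_nil mul0r.
by rewrite /tlen big_cons /= -natr1 mulrDl mul1r addrC lerD.
Qed.

(** Only a [v] starting to the right of the start of [u] is considered; group elements of the
    opposite sign are handled by exchanging the two words. *)
Definition word_mixing (zeta : substitution m) (d : R) u v :=
  exists r : R, forall g, r <= g -> exists2 x, subst_seqs zeta x &
  exists s : nat, [/\ window x 0 (size u) = u, window x s%:Z (size v) = v &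
    `|tlen (window x 0 s) - g| < d].

End Lengths.

Lemma tlen1 (R : realType) m (w : seq 'I_m) : tlen (fun=> 1 : R) w = (size w)%:R.
Proof.
by elim: w => [|i w IH]; rewrite /tlen ?big_nil// big_cons [X in _ + X]IH nat1r.
Qed.

Lemma tlen_iter_subst (R : realType) (m : nat) (zeta : substitution m)
  (t : 'I_m -> R) k w :
  tlen t (iter k (subst_word zeta) w) = tlen (fun i => tlen t (subst_iter zeta k i)) w.
Proof.
elim: w => [|i w IH]; first by rewrite iter_subst_nil /tlen !big_nil.
by rewrite -cat1s iter_subst_cat !tlen_cat IH /tlen big_seq1.
Qed.

(** * Unbounded imbalance yields mixing of words *)

Section TwoLetters.
Variable R : realType.
Implicit Types (t : 'I_2 -> R) (u v w : seq 'I_2).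

Lemma ord2_neq0 (i : 'I_2) : i != 0 -> i = 1.
Proof. by case: i => -[|[|//]] // h _; apply/val_inj. Qed.

Lemma tlenE t w : tlen t w =
  (count_mem 0 w)%:R * t 0 + ((size w)%:R - (count_mem 0 w)%:R) * t 1.
Proof.
elim: w => [|i w IH]; first by rewrite /tlen big_nil /= !mul0r subrr mul0r addr0.
rewrite /tlen big_cons -/(tlen t w) IH /= natrD -natr1.
have [->|/ord2_neq0 ->] := eqVneq i 0; rewrite /=; ring.
Qed.

Variables (zeta : substitution 2).
Local Notation X := (subst_seqs zeta).
Local Notation a := (min_count zeta 0).
Local Notation b := (max_count zeta 0).

(* The words of length [n] with [p] zeros, for [a n <= p < b n], contain one
   beginning with 1 and followed by 0; inflating it puts [v], a factor of
   [zeta^k(0)], at a distance from [u], a factor of [zeta^k(1)], that depends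
   only on [n] and [p]. *)
Lemma unbalanced_word_mixing t d : X !=set0 ->
  (forall A, exists N, forall n, (N <= n)%N -> (A <= b n - a n)%N) ->
  (forall i, 0 < t i) ->
  (forall k, (0 < k)%N -> approximable
    (tlen t (subst_iter zeta k 0)) (tlen t (subst_iter zeta k 1)) d) ->
  forall u v, allowed zeta u -> allowed zeta v -> word_mixing t zeta d u v.
Proof.
move=> X0 ab t0 apx u v /allowed_infix_iter[K HK] /allowed_infix_iter[K' HK'].
pose k := (K + K').+1.
have /infixP[s [s' su]] := HK k 1 (leqW (leq_addr _ _)).
have /infixP[r [r' rv]] := HK' k 0 (leqW (leq_addl _ _)).
have Lt i : 0 < tlen t (subst_iter zeta k i) by rewrite tlen_gt0// subst_iter_gt0.
have [q Hq] := strip_hits (Lt 0) (Lt 1) (min_count0 0 X0) (max_count0 0 X0)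
  (min_countS 0 X0) (max_countS 0 X0) ab (apx k isT).
have t0' i : 0 <= t i by exact: ltW.
exists (q + tlen t r) => g qg.
(* [u] begins after [s] and [v] begins after [r], so their distance is the length of the inflated
   word, minus that of [s], plus that of [r]. *)
have [|n [p [pab hit]]] := Hq (g - tlen t r + tlen t s).
  by have := tlen_ge0 s t0'; lra.
have [x xX [xp x0 xn]] := count_increase X0 pab.
have {}x0 := ord2_neq0 x0.
case: n => [|n] in pab hit xp xn *; first by rewrite x0 in xn.
have := allowed_iter_subst k (allowed_window 0 n.+2 xX).
have lW := tlen_iter_subst zeta t k (window x 0 n.+1).
rewrite -[n.+2]addn1 window_cat window1 add0r xn iter_subst_cat -/(subst_iter zeta k 0) rv.
rewrite [RHS]tlenE xp size_window in lW; rewrite -{}lW in hit.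
rewrite -[n.+1]add1n window_cat window1 x0 iter_subst_cat -/(subst_iter zeta k 1) su
  in hit *.
set z := iter _ _ _ in hit *.
move=> /allowed_at0[y yX yw].
exists (translate_seq (size s)%:Z y); first exact: subst_seqs_translate.
exists (size (u ++ s' ++ z ++ r)); rewrite !window_translate add0r; split.
- by move: yw; rewrite -!catA => /window_infix; rewrite add0r.
- rewrite -!catA in yw.
  move: yw; have -> : s ++ u ++ s' ++ z ++ r ++ v ++ r' =
    (s ++ u ++ s' ++ z ++ r) ++ v ++ r' by rewrite -!catA.
  by move/window_infix; rewrite add0r [size (s ++ _)]size_cat PoszD addrC.
- rewrite -!catA in yw.
  move: yw; have -> : s ++ u ++ s' ++ z ++ r ++ v ++ r' =
    s ++ (u ++ s' ++ z ++ r) ++ v ++ r' by rewrite -!catA.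
  move/window_infix; rewrite add0r => ->.
  move: hit; rewrite !tlen_cat; apply: le_lt_trans.
  by rewrite le_eqVlt; apply/orP; left; apply/eqP; congr `|_|; ring.
Qed.

End TwoLetters.

(** * Letter counts and the substitution matrix *)

Lemma count_subst_word m (zeta : substitution m) (i : 'I_m) w :
  count_mem i (subst_word zeta w) =
  (\sum_j subst_mx zeta i j * count_mem j w)%N.
Proof.
elim: w => [|j w IH]; first by rewrite big1// => j _; rewrite muln0.
rewrite -cat1s subst_word_cat count_cat IH /subst_word /= cats0.
under [RHS]eq_bigr do rewrite mulnDr.
rewrite big_split /=; congr addn.
rewrite (bigD1 j)//= eqxx muln1 mxE big1 ?addn0// => l lj.
by rewrite eq_sym (negbTE lj) muln0.
Qed.

Lemma count_subst_iter m (zeta : substitution m) k (i j : 'I_m) :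
  count_mem i (subst_iter zeta k j) = (subst_mx zeta ^+ k) i j.
Proof.
elim: k i => [|k IH] i.
  by rewrite expr0 /= addn0 /GRing.one /= mxE eq_sym; case: (i == j).
rewrite exprS -mulmxE mxE subst_iterS count_subst_word.
by apply: eq_bigr => l _; rewrite IH.
Qed.

Lemma primitive_mem m (zeta : substitution m) : primitive zeta ->
  exists k, forall i j, i \in subst_iter zeta k j.
Proof.
move=> [k _ kP]; exists k => i j.
by rewrite -has_pred1 has_count count_subst_iter.
Qed.

Lemma count_iter_subst_ge m (zeta : substitution m) k i w :
  (forall j, i \in subst_iter zeta k j) ->
  (size w <= count_mem i (iter k (subst_word zeta) w))%N.
Proof.
move=> H; elim: w => [|j w IH] //; rewrite -cat1s iter_subst_cat count_cat size_cat.
by rewrite leq_add//= -has_count has_pred1; exact: H.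
Qed.

(** * Letter frequency and discrepancy *)

Section Balanced.
Variables (R : realType) (m : nat) (zeta : substitution m) (i : 'I_m).
Local Notation X := (subst_seqs zeta).
Local Notation a := (min_count zeta i).
Local Notation b := (max_count zeta i).
Hypothesis X_neq0 : X !=set0.
Implicit Types (x : biseq m).

(** Cut the window into [k] blocks of length [n]. *)
Lemma count_window_mul x n k : X x ->
  (k * a n <= count_mem i (window x 0 (k * n)) <= k * b n)%N.
Proof.
move=> xX; elim: k => // k IH; rewrite !mulSnr window_cat count_cat.
have := min_count_le_window i (0 + (k * n)%N%:Z) n xX.
have := max_count_ge_window i (0 + (k * n)%N%:Z) n xX.
by move=> h1 h2; case/andP: IH => h3 h4; rewrite !leq_add.
Qed.

(* [a] is superadditive and [b] is subadditive, so [sup a(n)/n <= inf b(n)/n]. *)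
Lemma frequency_exists : exists alpha : R, forall n,
  (a n)%:R <= alpha * n%:R <= (b n)%:R.
Proof.
have [x xX] := X_neq0.
(* Count the zeros of a window of length [n * n'] by blocks of either length. *)
have mulab n n' : (a n * n' <= b n' * n)%N.
  rewrite mulnC; have /andP[+ _] := count_window_mul n n' xX.
  move=> /leq_trans; apply.
  by rewrite mulnC; have /andP[_ +] := count_window_mul n' n xX; rewrite [(_ * b _)%N]mulnC.
pose S := [set r : R | exists2 n, (0 < n)%N & r = (a n)%:R / n%:R].
have Sb n : (0 < n)%N -> ubound S ((b n)%:R / n%:R).
  move=> n0 _ [n' n'0 ->]; rewrite ler_pdivrMr ?ltr0n// mulrAC ler_pdivlMr ?ltr0n//.
  by rewrite -!natrM ler_nat.
have S0 : S !=set0 by exists ((a 1)%:R / 1%:R); exists 1%N.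
have S1 : has_ubound S by exists ((b 1)%:R / 1%:R); exact: Sb.
exists (sup S) => n; have [->|n0] := posnP n.
  by rewrite mulr0 min_count0// max_count0// lexx.
rewrite -ler_pdivrMr ?ltr0n// -[X in _ && X]ler_pdivlMr ?ltr0n//.
by rewrite ub_le_sup//=; [exact: ge_sup (Sb _ n0)|exists n].
Qed.

Definition discrepancy (alpha : R) x n : R :=
  (count_mem i (window x 0 n))%:R - alpha * n%:R.

Lemma discrepancyD alpha x n k : discrepancy alpha x (n + k) =
  discrepancy alpha x n + discrepancy alpha (translate_seq n%:Z x) k.
Proof.
rewrite /discrepancy window_cat count_cat window_translate add0r !natrD; ring.
Qed.

Variable K : nat.
Hypothesis bounded : forall n, (b n <= a n + K)%N.

(** Both the count and [alpha * n] lie between [a n] and [b n]. *)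
Lemma discrepancy_bounded alpha x n :
  (forall n, (a n)%:R <= alpha * n%:R <= (b n)%:R) -> X x ->
  `|discrepancy alpha x n| <= K%:R.
Proof.
move=> /(_ n)/andP[h1 h2] xX; rewrite ler_norml /discrepancy.
have := min_count_le_window i 0 n xX; rewrite -(ler_nat R) => h3.
have := max_count_ge_window i 0 n xX; rewrite -(ler_nat R) => h4.
have := bounded n; rewrite -(ler_nat R) natrD => h5.
by apply/andP; split; lra.
Qed.

(* If the discrepancy of [w] is nearly extremal, then from [|D + D w| <= sup]
   and [|D - D w| <= sup] the discrepancy [D] between two occurrences of [w] is
   nearly zero. *)
Lemma return_discrepancy alpha :
  (forall n, (a n)%:R <= alpha * n%:R <= (b n)%:R) -> forall e, 0 < e ->
  exists w, [/\ allowed zeta w, (0 < size w)%N & forall x s, X x ->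
    (size w <= s)%N -> window x 0 (size w) = w -> window x s%:Z (size w) = w ->
    `|discrepancy alpha x s| < e].
Proof.
move=> alphaP e e0.
(* Only the lengths [n.+1] enter, so that the chosen word is nonempty; length 0 has discrepancy 0
   and does not raise the supremum. *)
pose S := [set `|discrepancy alpha xn.1 xn.2.+1| | xn in [set xn | X xn.1]].
have [x0 x0X] := X_neq0.
have hS : has_sup S.
  split; first by exists `|discrepancy alpha x0 1|; exists (x0, 0%N).
  by exists K%:R => _ [[x n] /= xX <-]; exact: discrepancy_bounded.
have le x n : X x -> `|discrepancy alpha x n| <= sup S.
  move=> xX; have Sn k : `|discrepancy alpha x k.+1| <= sup S.
    by apply: ub_le_sup; [case: hS | exists (x, k)].
  case: n => //; apply: le_trans (Sn 0%N).
  by rewrite /discrepancy /= mulr0 subrr normr0.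
have [_ [[x n] /= xX <-] xn] := sup_adherent e0 hS.
exists (window x 0 n.+1); rewrite size_window; split => //; first exact: allowed_window.
move=> y s yX ns y0 ys.
have Dxy z : window z 0 n.+1 = window x 0 n.+1 ->
    discrepancy alpha z n.+1 = discrepancy alpha x n.+1.
  by rewrite /discrepancy => ->.
(* The gap between the two occurrences has discrepancy [D - D w]; the stretch from the start of the
   first to the end of the second has [D + D w]. *)
have h1 := le (translate_seq n.+1%:Z y) (s - n.+1)%N (subst_seqs_translate _ yX).
have h2 := discrepancyD alpha y n.+1 (s - n.+1)%N.
rewrite subnKC// Dxy// in h2.
have := le y (s + n.+1)%N yX.
rewrite discrepancyD Dxy; last by rewrite window_translate add0r.
move: xn h1; rewrite /= {}h2.
move: (sup S) (discrepancy alpha x n.+1) (discrepancy alpha _ (s - n.+1)).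
move=> B c d; rewrite !ler_norml ltr_norml.
case: (leP 0 c) => c0 h1 /andP[h2 h3] /andP[h4 h5]; apply/andP;
  rewrite ?(ger0_norm c0) ?(ltr0_norm c0) in h1; split; lra.
Qed.
End Balanced.

(** * Bounded imbalance excludes mixing of words *)

Section Converse.
Variables (R : realType) (zeta : substitution 2).
Local Notation X := (subst_seqs zeta).
Local Notation a := (min_count zeta 0).
Local Notation b := (max_count zeta 0).
Hypothesis X_neq0 : X !=set0.
Implicit Types (t : 'I_2 -> R) (u v w : seq 'I_2).

Lemma count_mem01 w : (count_mem 0%R w + count_mem 1%R w)%N = size w.
Proof.
elim: w => //= i w <-.
have [->|/ord2_neq0 ->] := eqVneq i 0; first by rewrite /=; lia.
by rewrite eqxx /=; lia.
Qed.

(** By primitivity the image under some [zeta^k] of a word of [K + 1] letters has more than [K]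
    zeros and more than [K] ones. By balance every allowed word of the same length then has at least
    one of each. *)
Lemma frequency_itv (alpha : R) K : primitive zeta ->
  (forall n, (b n <= a n + K)%N) ->
  (forall n, (a n)%:R <= alpha * n%:R <= (b n)%:R) -> 0 < alpha < 1.
Proof.
move=> /primitive_mem[k Hk] abK alphaP; have [x xX] := X_neq0.
have := allowed_iter_subst k (allowed_window 0 K.+1 xX).
set w := iter _ _ _ => -[y yX [j yw]].
have c0 := count_iter_subst_ge (window x 0 K.+1) (Hk 0).
have c1 := count_iter_subst_ge (window x 0 K.+1) (Hk 1).
rewrite size_window -/w in c0 c1.
have c01 := count_mem01 w.
have aw := min_count_le_window 0 j (size w) yX.
have bw := max_count_ge_window 0 j (size w) yX.
rewrite yw in aw bw.
have an : (1 <= a (size w))%N.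
  by rewrite -(leq_add2r K); apply: leq_trans (abK _); apply: leq_trans bw.
have bn : (b (size w) < size w)%N.
  by apply: leq_ltn_trans (abK _) _; rewrite -[X in (_ < X)%N]c01 -addnS leq_add.
have /andP[h1 h2] := alphaP (size w).
have n0 : (0 < size w)%N by apply: leq_ltn_trans bn.
have n0' : 0 < (size w)%:R :> R by rewrite ltr0n.
apply/andP; split; rewrite -(ltr_pM2r n0').
  by rewrite mul0r (lt_le_trans _ h1)// ltr0n.
by rewrite mul1r (le_lt_trans h2)// ltr_nat.
Qed.

(* For [g] the length of a word of [n] letters with [a n] zeros, the number [s] of
   letters from [u] to [v] is close to [n] because [b n - a n <= K], and then
   equal to [n] by the separation hypothesis. *)
Lemma mixing_bounded t K : (forall i, 0 < t i) ->
  (forall N, exists2 n, (N <= n)%N & (b n <= a n + K)%N) ->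
  (forall C : nat, exists d : R, [/\ d <= 1,
    forall i j : int, (absz i <= C)%N -> (absz j <= C)%N ->
      `|i%:~R * t 0 + j%:~R * t 1| < d -> i + j = 0 &
    forall u v, allowed zeta u -> allowed zeta v -> (0 < size u)%N ->
      (0 < size v)%N -> word_mixing t zeta d u v]) ->
  forall n, (b n <= a n + K)%N.
Proof.
move=> t0 abK mix l; have [->|l0] := posnP l; first by rewrite max_count0.
pose M := Num.max (t 0) (t 1); pose e := Num.min (t 0) (t 1).
have tM i : t i <= M.
  by have [->|/ord2_neq0 ->] := eqVneq i 0; rewrite le_max lexx ?orbT.
have te i : e <= t i.
  by have [->|/ord2_neq0 ->] := eqVneq i 0; rewrite ge_min lexx ?orbT.
have e0 : 0 < e by rewrite lt_min !t0.
(* [1 + K * M] will bound the length of the word between positions [s] and [n], which therefore has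
   fewer than [S] letters. Then [K + 2 * S] bounds both coefficients in the separation
   hypothesis. *)
have [S SE] : exists S : nat, 1 + K%:R * M < S%:R * e.
  exists (Num.truncn ((1 + K%:R * M) / e)).+1; rewrite -ltr_pdivrMr//.
  by rewrite truncnS_gt.
have [d [d1 sep {}mix]] := mix (K + 2 * S)%N.
(* For [u] take a word of length [l] with the fewest zeros, for [v] one with the most. *)
have [y yX [j yj]] := min_count_window 0 X_neq0 l.
have [z zX [k zk]] := max_count_window 0 X_neq0 l.
have [||r Hr] := mix _ _ (allowed_window j l yX) (allowed_window k l zX);
  rewrite ?size_window//.
have [n nr abn] := abK (Num.truncn (r / e)).+1.
pose g := (a n)%:R * t 0 + (n%:R - (a n)%:R) * t 1.
have rg : r <= g.
  have an : (a n)%:R <= n%:R :> R.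
    have [x xX [i <-]] := min_count_window 0 X_neq0 n.
    by rewrite ler_nat -{2}(size_window x i n) count_size.
  have : r <= n%:R * e.
    rewrite -ler_pdivrMr// ltW// (lt_le_trans (truncnS_gt _))// ler_nat//.
  by have := te 0; have := te 1; have : 0 <= (a n)%:R :> R by []; rewrite /g; nra.
have {Hr} [x xX [s []]] := Hr g rg; rewrite !size_window => x0 xs xg.
have an := min_count_le_window 0 0 n xX; have bn := max_count_ge_window 0 0 n xX.
have gn : tlen t (window x 0 n) - g =
    ((count_mem 0%R (window x 0 n))%:R - (a n)%:R) * (t 0 - t 1).
  by rewrite tlenE size_window /g; ring.
have gnK : `|tlen t (window x 0 n) - g| <= K%:R * M.
  rewrite gn normrM ler_pM// -?natrB//.
    by rewrite normr_nat ler_nat leq_subLR (leq_trans bn).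
  rewrite ler_norml; have := tM 0; have := tM 1; have := t0 0; have := t0 1.
  by move=> *; apply/andP; split; lra.
have close (p q : nat) (w : seq 'I_2) : (q <= p)%N -> size w = (p - q)%N ->
    tlen t w <= 1 + K%:R * M -> (p < q + S)%N.
  move=> qp sw tw; rewrite -ltn_subLR// -sw -(ltr_nat R) -(ltr_pM2r e0).
  by apply: le_lt_trans (le_lt_trans tw SE); exact: tlen_ge_size.
have sn : (s < n + S)%N /\ (n < s + S)%N /\
    (count_mem 0%R (window x 0 s) <= count_mem 0%R (window x 0 n) + (s - n))%N /\
    (count_mem 0%R (window x 0 n) <= count_mem 0%R (window x 0 s) + (n - s))%N.
  move: gnK xg; rewrite !ltr_norml !ler_norml => /andP[h1 h2] /andP[h3 h4].
  have [le|/ltnW le] := leqP s n.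
    have := window_cat x 0 s (n - s); rewrite subnKC// => E.
    have := count_size (pred1 (0 : 'I_2)) (window x (0 + s%:Z) (n - s)).
    rewrite size_window E tlen_cat in h1 h2 *.
    have := close _ _ _ le (size_window x (0 + s%:Z) (n - s)).
    rewrite count_cat => c1 c2; have {}c1 := c1 (ltac:(lra)).
    move: c2 {h1 h2 h3 h4 E}; move: (count _ _) (count _ _) => p q; clear -c1 le.
    by repeat split; lia.
  have := window_cat x 0 n (s - n); rewrite subnKC// => E.
  have := count_size (pred1 (0 : 'I_2)) (window x (0 + n%:Z) (s - n)).
  rewrite size_window E tlen_cat in h3 h4 *.
  have := close _ _ _ le (size_window x (0 + n%:Z) (s - n)).
  rewrite count_cat => c1 c2; have {}c1 := c1 (ltac:(lra)).
  move: c2 {h1 h2 h3 h4 E}; move: (count _ _) (count _ _) => p q; clear -c1 le.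
  by repeat split; lia.
have sE : s = n.
  have : s%:Z - n%:Z = 0; last by lia.
  (* The length of the first [s] tiles minus [g] is an integer combination of [t 0] and [t 1] whose
     coefficients add up to [s - n]. *)
  have := sep ((count_mem 0%R (window x 0 s))%:Z - (a n)%:Z)
    ((s%:Z - n%:Z) - ((count_mem 0%R (window x 0 s))%:Z - (a n)%:Z)).
  rewrite [X in X = 0](_ : _ = s%:Z - n%:Z); last by ring.
  have abn' := leq_trans bn abn.
  rewrite tlenE size_window /g in xg.
  move: (count_mem _ _) (count_mem _ _) (a n) sn an abn' xg => p p' an.
  move=> [s1 [s2 [s3 s4]]] p1 p2 xg; apply.
  - by clear -s1 s2 s3 s4 p1 p2; lia.
  - by clear -s1 s2 s3 s4 p1 p2; lia.
  - apply: le_lt_trans xg; rewrite le_eqVlt; apply/orP; left; apply/eqP.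
    by congr `|_|; rewrite !intrB -!pmulrn; ring.
rewrite sE in xs.
(* Count the zeros of the first [l + n] letters, split at [l] and at [n]. *)
have : (count_mem 0%R (window x 0 l) + count_mem 0%R (window x (0 + l%:Z) n) =
  count_mem 0%R (window x 0 n) + count_mem 0%R (window x (0 + n%:Z) l))%N.
  by rewrite -!count_cat -!window_cat addnC.
rewrite x0 add0r [0 + n%:Z]add0r xs yj zk.
have := max_count_ge_window 0 l%:Z n xX.
move: (count_mem _ _) (count_mem _ _) an {bn gn gnK sn xg} => p q.
clear -abn; lia.
Qed.

(** For some [n], both [alpha * n] and [alpha * (n + 1)] lie within half of [min(alpha, 1 - alpha)]
    of integers. Their difference [alpha] would be closer to an integer than it is. *)
Lemma balanced_not_mixing_unit K : primitive zeta ->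
  (forall n, (b n <= a n + K)%N) ->
  ~ forall u v, allowed zeta u -> allowed zeta v -> (0 < size u)%N ->
      (0 < size v)%N -> word_mixing (fun=> 1 : R) zeta 1 u v.
Proof.
move=> prim abK mix.
have [alpha alphaP] := frequency_exists R 0 X_neq0.
have /andP[alpha0 alpha1] := frequency_itv prim abK alphaP.
have e0 : 0 < Num.min alpha (1 - alpha) / 2.
  by rewrite divr_gt0// lt_min alpha0 subr_gt0.
have [w [wA w0 wP]] := return_discrepancy X_neq0 abK alphaP e0.
have [r Hr] := mix w w wA wA w0 w0.
have hit n : r <= n%:R -> (size w <= n)%N -> exists p : nat,
    `|p%:R - alpha * n%:R| < Num.min alpha (1 - alpha) / 2.
  move=> /Hr[x xX [s [x0 xs]]].
  rewrite tlen1 size_window => sn; have {sn}<- : s = n.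
    have : `|s%:Z - n%:Z| < 1; last by lia.
    by rewrite -(ltr_int R) intr_norm intrB -!pmulrn.
  by move=> /(wP _ _ xX)/(_ x0 xs); exists (count_mem 0 (window x 0 s)).
pose n := maxn (size w) (Num.truncn r).+1.
have rn : r <= n%:R.
  by rewrite ltW// (lt_le_trans (truncnS_gt _))// ler_nat leq_maxr.
have [p Hp] := hit n rn (leq_maxl _ _).
have rn1 : r <= n.+1%:R by rewrite (le_trans rn)// ler_nat.
have [q Hq] := hit n.+1 rn1 (leqW (leq_maxl _ _)).
have mina : Num.min alpha (1 - alpha) <= alpha by rewrite ge_min lexx.
have minb : Num.min alpha (1 - alpha) <= 1 - alpha by rewrite ge_min lexx orbT.
move: (Num.min _ _) Hp Hq mina minb => mu.
rewrite -[n.+1%:R]natr1 !ltr_norml => /andP[p1 p2] /andP[q1 q2] mu1 mu2.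
have : p%:R < q%:R :> R by lra.
have : q%:R < p%:R + 1 :> R by lra.
by rewrite natr1 !ltr_nat ltnS leqNgt => /negbTE ->.
Qed.

(** With [c] the mean tile length, a return after [s] tiles has length [s * c] up to an error below
    [c / 4]. It cannot lie within [c / 4] of a half-integer multiple [N * c + c / 2]. *)
Lemma balanced_not_mixing_real K t : primitive zeta -> (forall i, 0 < t i) ->
  (forall n, (b n <= a n + K)%N) ->
  ~ forall d u v, 0 < d -> allowed zeta u -> allowed zeta v -> (0 < size u)%N ->
      (0 < size v)%N -> word_mixing t zeta d u v.
Proof.
move=> prim t0 abK mix.
have [alpha alphaP] := frequency_exists R 0 X_neq0.
have /andP[alpha0 alpha1] := frequency_itv prim abK alphaP.
pose c := alpha * t 0 + (1 - alpha) * t 1.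
have c0 : 0 < c by rewrite addr_gt0// mulr_gt0// subr_gt0.
pose T := t 0 + t 1.
have T0 : 0 < T by rewrite addr_gt0.
have e0 : 0 < c / 4 / T by rewrite !divr_gt0.
have [w [wA w0 wP]] := return_discrepancy X_neq0 abK alphaP e0.
have d0 : 0 < c / 4 by rewrite divr_gt0.
have [r Hr] := mix _ w w d0 wA wA w0 w0.
(* [N] is large enough for [g] to exceed [r] and for the two occurrences of [w] to be disjoint. *)
pose N := (Num.truncn ((`|r| + (size w)%:R * T) / c)).+1.
have NE : `|r| + (size w)%:R * T < N%:R * c by rewrite -ltr_pdivrMr// truncnS_gt.
have wT0 : 0 <= (size w)%:R * T by rewrite mulr_ge0// ltW.
pose g := N%:R * c + c / 2.
have [|x xX [s [x0 xs]]] := Hr g.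
  by rewrite (le_trans (ler_norm _))// /g; lra.
rewrite ltr_norml => /andP[g1 g2].
have tT i : t i <= T.
  by have := t0 0; have := t0 1; rewrite /T; have [->|/ord2_neq0 ->] := eqVneq i 0; lra.
have ws : (size w <= s)%N.
  rewrite -(ler_nat R) -(ler_pM2r T0).
  have := tlen_le_size (window x 0 s) tT; rewrite size_window.
  by have := normr_ge0 r; move: g1; rewrite /g; lra.
have := wP _ _ xX ws x0 xs.
rewrite /discrepancy; move: g1 g2; rewrite tlenE size_window.
move: (count_mem _ _) => p; set D := p%:R - alpha * s%:R => g1 g2.
rewrite ltr_pdivlMr// => DT.
have : `|D * (t 0 - t 1)| < c / 4.
  apply: le_lt_trans DT; rewrite normrM ler_wpM2l// ler_norml /T.
  by have := t0 0; have := t0 1; move=> *; apply/andP; split; lra.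
rewrite ltr_norml => /andP[D1 D2].
have E : p%:R * t 0 + (s%:R - p%:R) * t 1 = s%:R * c + D * (t 0 - t 1).
  by rewrite /D /c; ring.
rewrite {}E /g in g1 g2.
have : N%:R * c < s%:R * c by lra.
have : s%:R * c < N.+1%:R * c by rewrite -natr1; lra.
by rewrite !ltr_pM2r// !ltr_nat ltnS leqNgt => /negbTE ->.
Qed.
End Converse.

(** * The shift space *)

Section Shift.
Variables (m : nat) (zeta : substitution m).
Implicit Types (u v w : seq 'I_m).

Lemma eq_window (x y : biseq m) j n :
  (forall k, (k < n)%N -> x (j + k%:Z) = y (j + k%:Z)) -> window x j n = window y j n.
Proof.
move=> H; rewrite /window /mkseq; apply/eq_in_map => k.
by rewrite mem_iota add0n => /H.
Qed.

Lemma window_inj (x y : biseq m) j n : window x j n = window y j n ->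
  forall k, (k < n)%N -> x (j + k%:Z) = y (j + k%:Z).
Proof.
by move=> xy k kn; rewrite -(nth_window (x 0) x j kn) xy nth_window.
Qed.

Lemma open_cylinder j n w : open [set x : subst_space zeta | window (val x) j n = w].
Proof.
rewrite openE => x /= xw; rewrite /interior.
have H (k : 'I_n) : \forall y \near x, val y (j + k%:Z) = val x (j + k%:Z).
  have valc : {for x, continuous (fun y : subst_space zeta => (val y : biseq m))}.
    exact: initial_continuous.
  have pc : {for (val x : biseq m), continuous (proj (j + k%:Z) : biseq m -> _)}.
    exact: proj_continuous.
  have := continuous_comp valc pc.
  move=> /(_ _ (discrete_set1 (val x (j + k%:Z) : discrete_topology 'I_m))).
  exact.
near=> y; rewrite /= -xw; apply: eq_window => k kn.
have yx : forall k : 'I_n, val y (j + k%:Z) = val x (j + k%:Z).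
  by near: y; exact: filter_forall.
exact: (yx (Ordinal kn)).
Unshelve. all: by end_near. Qed.

(** The sets containing a central cylinder around [x] form a filter. It converges to [x] in each
    coordinate, hence in the product topology, so it contains every open set around [x]. *)
Lemma open_sub_cylinder (U : set (subst_space zeta)) x : open U -> U x ->
  exists n : nat, forall y,
    window (val y) (- n%:Z) (n + n).+1 = window (val x) (- n%:Z) (n + n).+1 -> U y.
Proof.
move=> oU Ux.
pose F : set_system (biseq m) := [set A | exists n : nat, forall y,
    window y (- n%:Z) (n + n).+1 = window (val x) (- n%:Z) (n + n).+1 -> A y].
have FF : Filter F.
  split.
  - by exists 0%N.
  - move=> A B [n Hn] [k Hk]; exists (maxn n k) => y yx.
    split; [apply: Hn|apply: Hk]; apply: eq_window => l ln.
      have := window_inj yx (k := (maxn n k - n + l)%N).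
      have -> : - (maxn n k)%:Z + (maxn n k - n + l)%:Z = - n%:Z + l%:Z by lia.
      by apply; lia.
    have := window_inj yx (k := (maxn n k - k + l)%N).
    have -> : - (maxn n k)%:Z + (maxn n k - k + l)%:Z = - k%:Z + l%:Z by lia.
    by apply; lia.
  - by move=> A B AB [n Hn]; exists n => y /Hn /AB.
have : F --> (val x : biseq m).
  apply/cvg_sup => i A /= [_ [[B oB <-] Bx] BA].
  exists (absz i) => y yx; apply: BA => /=.
  have := window_inj yx (k := absz (i + (absz i)%:Z)).
  have -> : - (absz i)%:Z + (absz (i + absz i))%:Z = i by lia.
  by rewrite /proj => ->//; lia.
have [V oV VU] : exists2 V : set (biseq m), open V & val @^-1` V = U.
  by case: oU => V oV VU; exists V.
move=> /(_ V); case.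
  by apply: open_nbhs_nbhs; split=> //; rewrite -VU in Ux.
by move=> n Hn; exists n => y /Hn; rewrite -VU.
Qed.
End Shift.

(** * Mixing of the shift and of words *)

Section ShiftMixing.
Variables (R : realType) (m : nat) (zeta : substitution m).
Implicit Types (u v w : seq 'I_m).
Local Notation X := (subst_seqs zeta).

(** Integers at distance less than 1 are equal, and a real [g] is served by its integer part. *)
Lemma word_mixing1P u v : word_mixing (fun=> 1 : R) zeta 1 u v <->
  exists N, forall n, (N <= n)%N -> exists2 x, X x &
    window x 0 (size u) = u /\ window x n%:Z (size v) = v.
Proof.
split=> [[r Hr]|[N HN]].
  exists (Num.truncn r).+1 => n nr.
  have [|x xX [s [x0 xs]]] := Hr n%:R.
    by rewrite ltW// (lt_le_trans (truncnS_gt _))// ler_nat.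
  rewrite tlen1 size_window => sn; exists x => //; split=> //.
  have {sn}<- // : s = n.
  have : `|s%:Z - n%:Z| < 1; last by lia.
  by rewrite -(ltr_int R) intr_norm intrB -!pmulrn.
exists N%:R => g Ng; have g0 : 0 <= g by exact: le_trans Ng.
have [|x xX [x0 xs]] := HN (Num.truncn g).
  by rewrite truncn_ge_nat.
exists x => //; exists (Num.truncn g); split=> //.
rewrite tlen1 size_window; have /andP[h1 h2] := truncn_itv g0.
by rewrite -natr1 in h2; rewrite ltr_norml; apply/andP; split; lra.
Qed.

Lemma shift_mixing_of_words :
  (forall u v, allowed zeta u -> allowed zeta v -> word_mixing (fun=> 1 : R) zeta 1 u v) ->
  topologically_mixing (subst_shift zeta).
Proof.
move=> mix U V oU oV [x Ux] [y Vy].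
have [n Hn] := open_sub_cylinder oU Ux; have [k Hk] := open_sub_cylinder oV Vy.
set u := window _ _ _ in Hn; set v := window _ _ _ in Hk.
have uA : allowed zeta u by apply: allowed_window; exact: set_mem (valP x).
have vA : allowed zeta v by apply: allowed_window; exact: set_mem (valP y).
have /word_mixing1P[N HN] := mix _ _ uA vA.
have /word_mixing1P[M HM] := mix _ _ vA uA.
have su : size u = (n + n).+1 by rewrite size_window.
have sv : size v = (k + k).+1 by rewrite size_window.
exists ((N + M + n + k).+1)%:Z => // g gN.
suff [z zX [zu zv]] : exists2 z, X z &
    window z (g - n%:Z) (size u) = u /\ window z (- k%:Z) (size v) = v.
  have zX' : z \in X by rewrite inE.
  pose z' : subst_space zeta := exist _ z zX'.
  exists (subst_shift zeta g z'); split.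
    by apply: Hn; rewrite window_translate -su addrC.
  by exists z' => //; apply: Hk; rewrite -sv.
(* [u] surrounds position [g] and [v] surrounds 0, so the sign of [g] decides which word comes
   first. *)
have [g0|g0] := leP 0 g.
  pose q : int := g - n%:Z + k%:Z.
  have [|z zX [z0 zs]] := HM (absz q); first by rewrite /q; lia.
  exists (translate_seq k%:Z z); first exact: subst_seqs_translate.
  rewrite !window_translate addNr; split=> //.
  by rewrite (_ : _ + _ = (absz q)%:Z)// /q; lia.
pose q : int := - g + n%:Z - k%:Z.
have [|z zX [z0 zs]] := HN (absz q); first by rewrite /q; lia.
exists (translate_seq (- g + n%:Z) z); first exact: subst_seqs_translate.
rewrite !window_translate; split.
  by rewrite (_ : _ + _ = 0)//; ring.
by rewrite (_ : _ + _ = (absz q)%:Z)// /q; lia.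
Qed.

Lemma word_mixing_of_shift : topologically_mixing (subst_shift zeta) ->
  forall u v, allowed zeta u -> allowed zeta v -> word_mixing (fun=> 1 : R) zeta 1 u v.
Proof.
move=> mix u v /allowed_at0[x xX xu] /allowed_at0[y yX yv].
have xX' : x \in X by rewrite inE.
have yX' : y \in X by rewrite inE.
have U0 : [set z : subst_space zeta | window (val z) 0 (size u) = u] !=set0.
  by exists (exist _ x xX').
have V0 : [set z : subst_space zeta | window (val z) 0 (size v) = v] !=set0.
  by exists (exist _ y yX').
have [r r0 Hr] := mix _ _ (open_cylinder _ _ _ _) (open_cylinder _ _ _ _) U0 V0.
apply/word_mixing1P; exists (absz r) => n nr.
have [|z' /= [zu [z zv zz']]] := Hr (- n%:Z); first by rewrite normrN; lia.
rewrite -zz' /= window_translate add0r in zu.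
exists (translate_seq (- n%:Z) (val z)).
  exact/subst_seqs_translate/set_mem/(valP z).
by rewrite !window_translate add0r subrr.
Qed.

End ShiftMixing.

(** * Tilings *)

Section WordTiles.
Variables (R : realType) (m : nat) (t : 'I_m -> {posnum R}).
Local Notation tile := (tile R m).
Local Notation len := (tlen (fun i => (t i)%:num)).
Implicit Types (c d x y z : R) (u v w : seq 'I_m) (S P : set tile) (T : tile).

Fixpoint word_tiles c w : seq tile :=
  if w is i :: w' then (c, i) :: word_tiles (c + (t i)%:num) w' else [::].

Lemma len_cons i w : len (i :: w) = (t i)%:num + len w.
Proof. exact: big_cons. Qed.

Lemma len_nil : len [::] = 0.
Proof. exact: big_nil. Qed.

Lemma len_ge0 w : 0 <= len w.
Proof. by apply: tlen_ge0. Qed.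

Lemma len_unbounded (x : R) : exists N, forall w, (N <= size w)%N -> x < len w.
Proof.
(* The default value 1 keeps the minimum positive whatever the alphabet. *)
pose e : R := \big[Num.min/1]_i (t i)%:num.
have e0 : 0 < e by apply/lt_bigmin.
exists (Num.truncn (x / e)).+1 => w Nw.
have /(lt_le_trans _) : (size w)%:R * e <= len w.
  by apply: tlen_ge_size => i; exact: bigmin_le_cond.
by apply; rewrite -ltr_pdivrMr// (lt_le_trans (truncnS_gt _))// ler_nat.
Qed.

Lemma word_tiles_cat c u v :
  word_tiles c (u ++ v) = word_tiles c u ++ word_tiles (c + len u) v.
Proof.
elim: u c => [|i u IH] c; first by rewrite len_nil addr0.
by rewrite /= IH len_cons addrA.
Qed.

Lemma word_tiles_labels c w : [seq T.2 | T <- word_tiles c w] = w.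
Proof. by elim: w c => //= i w IH c; rewrite IH. Qed.

Lemma word_tiles_itv c w T : T \in word_tiles c w ->
  c <= T.1 /\ tile_end t T <= c + len w.
Proof.
elim: w c => //= i w IH c; rewrite in_cons len_cons => /orP[/eqP ->|/IH[h1 h2]].
  by rewrite lexx addrA lerDl len_ge0.
by rewrite addrA; split=> //; rewrite (le_trans _ h1)// lerDl.
Qed.

Lemma word_tiles_sorted c w : sorted (fun T T' => T.1 < T'.1) (word_tiles c w).
Proof.
elim: w c => //= i w IH c; rewrite path_min_sorted//.
apply/allP => T /word_tiles_itv[h _] /=.
by rewrite (lt_le_trans _ h)// ltrDl.
Qed.

Lemma word_tiles_cover c w x : c <= x < c + len w ->
  exists2 T, T \in word_tiles c w & T.1 <= x < tile_end t T.
Proof.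
elim: w c => [|i w IH] c; first by rewrite len_nil addr0; case: leP.
rewrite len_cons addrA => /andP[cx xw] /=.
have [xi|xi] := ltP x (c + (t i)%:num).
  by exists (c, i); rewrite ?mem_head//= cx.
have [|T Tw Tx] := IH (c + (t i)%:num); first by rewrite xi.
by exists T => //; rewrite in_cons Tw orbT.
Qed.

Lemma mem_word_tiles c w T : T \in word_tiles c w ->
  exists w1 w2, w = w1 ++ T.2 :: w2 /\ T.1 = c + len w1.
Proof.
elim: w c => //= i w IH c; rewrite in_cons => /orP[/eqP ->|/IH[w1 [w2 [-> ->]]]].
  by exists [::], w; rewrite len_nil addr0.
by exists (i :: w1), w2; rewrite len_cons addrA.
Qed.

Lemma word_tiles_disjoint c w : trivIset [set` word_tiles c w] (tile_int t).
Proof.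
elim: w c => [|i w IH] c T T' /=; first by [].
have disj T1 x : T1 \in word_tiles (c + (t i)%:num) w -> tile_int t (c, i) x ->
    ~ tile_int t T1 x.
  move=> /word_tiles_itv[h _]; rewrite /tile_int /tile_end /= !in_itv /=.
  by move=> /andP[_ h1] /andP[h2 _]; move: (lt_trans h2 h1); rewrite ltNge h.
rewrite !in_cons => /orP[/eqP ->|Tw] /orP[/eqP ->|Tw'] // [x [xT xT']].
- by case: (disj _ _ Tw' xT).
- by case: (disj _ _ Tw xT').
- by apply: (IH (c + (t i)%:num)) => //; exists x.
Qed.

Lemma word_tiles_tiles c w : w != [::] ->
  tiles t [set` word_tiles c w] `[c, c + len w].
Proof.
move=> w0; split; last exact: word_tiles_disjoint.
apply/seteqP; split=> x /=.
  move=> [T /= /word_tiles_itv[h1 h2]]; rewrite /tile_supp /= !in_itv /=.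
  by move=> /andP[h3 h4]; rewrite (le_trans h1)//= (le_trans h4).
rewrite in_itv /= => /andP[cx]; rewrite le_eqVlt => /orP[/eqP xE|xw].
  (* The right endpoint escapes the half-open cover and lies in the last tile. *)
  case/lastP: w w0 xE => // w i _ xE.
  exists (c + len w, i); first by rewrite /= -cats1 word_tiles_cat mem_cat mem_head orbT.
  rewrite /tile_supp /tile_end /= in_itv /= xE -cats1 tlen_cat len_cons len_nil.
  by rewrite addr0 addrA lexx andbT lerDl.
have [|T Tw /andP[h1 h2]] := @word_tiles_cover c w x; first by rewrite cx.
by exists T => //; rewrite /tile_supp /= in_itv /= h1 ltW.
Qed.

Lemma word_tiles_patch c w : w != [::] -> is_patch t [set` word_tiles c w].
Proof.
move=> w0; exists c, (c + len w); split; last exact: word_tiles_tiles.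
by rewrite ltrDl tlen_gt0// lt0n size_eq0.
Qed.

Lemma word_tiles_label c w : label_word [set` word_tiles c w] w.
Proof.
by exists (word_tiles c w); rewrite word_tiles_labels word_tiles_sorted.
Qed.

Lemma translate_word_tiles y c w :
  translate y [set` word_tiles c w] = [set` word_tiles (c - y) w].
Proof.
have -> : word_tiles (c - y) w = [seq translate_tile y T | T <- word_tiles c w].
  by elim: w c => //= i w IH c; rewrite -IH addrAC.
apply/seteqP; split=> [_ /= [T Tw <-]|T /= /mapP[T' T'w ->]]; last by exists T'.
exact: map_f.
Qed.

Lemma tile_start_inj S T T' : tiles t S setT -> S T -> S T' -> T.1 = T'.1 -> T = T'.
Proof.
move=> [_ tS] ST ST' TT'; apply: (tile_overlap tS) => //.
  by rewrite TT' tile_lt_end.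
by rewrite -TT' tile_lt_end.
Qed.

(** The tile covering a point just after the end of [T] must start there. Otherwise the tile
    covering the middle of the gap would fit into the gap, which is shorter than every prototile. *)
Lemma next_tile S T : tiles t S setT -> S T -> exists2 T', S T' & T'.1 = tile_end t T.
Proof.
move=> [SE tS] ST; pose e : R := \big[Num.min/1]_i (t i)%:num.
have e0 : 0 < e by apply/lt_bigmin.
have te i : e <= (t i)%:num by exact: bigmin_le_cond.
have cover x : exists2 T', S T' & T'.1 <= x <= tile_end t T'.
  have : [set: R] x by []; rewrite -SE => -[T' ST'].
  by rewrite /tile_supp /= in_itv => xT'; exists T'.
clear SE.
have after x T' : S T' -> tile_end t T < x -> x <= tile_end t T' -> tile_end t T <= T'.1.
  move=> ST' Tx xT'; rewrite leNgt; apply/negP => T'T.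
  have TT' : T = T'.
    apply: (tile_overlap tS) => //; apply: lt_trans (tile_lt_end t T) _.
    exact: lt_le_trans Tx xT'.
  by move: xT'; rewrite -TT' leNgt Tx.
have [T' ST' /andP[T'1 T'2]] := cover (tile_end t T + e / 2).
have h1 : tile_end t T < tile_end t T + e / 2 by rewrite ltrDl divr_gt0.
have T'3 := after _ _ ST' h1 T'2.
exists T' => //; apply/eqP; rewrite eq_le T'3 andbT leNgt; apply/negP => T'4.
have [T2 ST2 /andP[T21 T22]] := cover ((tile_end t T + T'.1) / 2).
have h2 : tile_end t T < (tile_end t T + T'.1) / 2 by lra.
have T23 := after _ _ ST2 h2 T22.
have : tile_end t T2 <= T'.1.
  rewrite leNgt; apply/negP => T24.
  have T2T' : T2 = T'.
    by apply: (tile_overlap tS) => //; rewrite (lt_trans _ (tile_lt_end t T'))//; lra.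
  by rewrite T2T' in T21; lra.
by have := te T2.2; rewrite /tile_end in T23 T'1 * => teT2 T2e; lra.
Qed.

Lemma word_tiles_extend S T n : tiles t S setT -> S T -> exists w,
  size w = n /\ [set` word_tiles T.1 (T.2 :: w)] `<=` S.
Proof.
move=> tS; elim: n T => [|n IH] T ST.
  exists [::]; split=> // T' /=; rewrite inE => /eqP ->.
  by case: T ST.
have [T' ST' T'E] := next_tile tS ST; have [w [<- wS]] := IH _ ST'.
exists (T'.2 :: w); split=> // T1; rewrite [word_tiles _ _]/= => /=.
rewrite in_cons => /orP[/eqP ->|]; first by case: T ST {T'E}.
by move=> T1w; apply: wS; rewrite /= T'E.
Qed.

Lemma word_tiles_prefix S c u w : tiles t S setT ->
  [set` word_tiles c u] `<=` S -> [set` word_tiles c w] `<=` S ->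
  (size u <= size w)%N -> take (size u) w = u.
Proof.
move=> tS; elim: u c w => [|i u IH] c w; first by rewrite take0.
case: w => // j w uS wS /= uw.
have [ij] : (c, i) = (c, j) :> tile.
  by apply: (tile_start_inj tS) => //; [apply: uS|apply: wS]; rewrite /= mem_head.
rewrite -{}ij in wS *; congr cons.
apply: (IH (c + (t i)%:num)) => //.
  by move=> T Tu; apply: uS; rewrite /= in_cons [_ \in _]Tu orbT.
by move=> T Tu; apply: wS; rewrite /= in_cons [_ \in _]Tu orbT.
Qed.

Lemma mem_word_tiles_itv S c w T : tiles t S setT -> [set` word_tiles c w] `<=` S ->
  S T -> c <= T.1 < c + len w -> T \in word_tiles c w.
Proof.
move=> [_ tS] wS ST /word_tiles_cover[T' T'w /andP[h1 h2]].
suff -> : T = T' by [].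
by apply: (tile_overlap tS) => //; [exact: wS|exact: le_lt_trans (tile_lt_end t T)].
Qed.

End WordTiles.

(** * Tilings built from sequences *)

Section SeqTiling.
Variables (R : realType) (m : nat) (t : 'I_m -> {posnum R}) (zeta : substitution m).
Local Notation tile := (tile R m).
Local Notation len := (tlen (fun i => (t i)%:num)).
Local Notation X := (subst_seqs zeta).
Implicit Types (c d y z : R) (x : biseq m) (u v w : seq 'I_m).

(** Tiles starting before [c] are dropped; among the remaining ones only the condition at [d]
    matters, and it selects a prefix. *)
Lemma filter_word_tiles c d c0 w :
  exists2 w', infix w' w & [seq T.2 | T <- word_tiles t c0 w
    & (c <= T.1) && (tile_end t T <= d)] = w'.
Proof.
have aux c1 w1 : c <= c1 -> exists2 w', prefix w' w1 &
    [seq T.2 | T <- word_tiles t c1 w1 & (c <= T.1) && (tile_end t T <= d)] = w'.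
  elim: w1 c1 => [|i w1 IH] c1 cc1; first by exists [::].
  rewrite /= cc1 /tile_end /=.
  have cc1' : c <= c1 + (t i)%:num by rewrite (le_trans cc1)// lerDl.
  have [id|di] := leP (c1 + (t i)%:num) d.
    have [w' w'w /= ->] := IH _ cc1'.
    by exists (i :: w') => //=; rewrite eqxx.
  exists [::] => //; rewrite (@eq_in_filter _ _ pred0) ?filter_pred0// => T.
  move=> /word_tiles_itv[h _]; apply/negbTE; rewrite negb_and -!ltNge.
  by rewrite (lt_le_trans di) ?orbT// (le_trans h)// ltW// tile_lt_end.
elim: w c0 => [|i w IH] c0; first by exists [::].
have [cc0|c0c] := leP c c0.
  by have [w' /prefixW w'w e] := aux c0 (i :: w) cc0; exists w'.
have [w' w'w e] := IH (c0 + (t i)%:num).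
by exists w'; [rewrite -cat1s infix_catl | rewrite /= leNgt c0c].
Qed.

(** The left end is chosen so that the tile of [x 0] starts at 0 for every [n], which makes the
    patches nested. *)
Definition central_tiles x n :=
  word_tiles t (- len (window x (- n%:Z) n)) (window x (- n%:Z) (n + n)).

Definition seq_tiling x : set tile := \bigcup_n [set` central_tiles x n].

Lemma central_tiles_sub x n k : (n <= k)%N ->
  {subset central_tiles x n <= central_tiles x k}.
Proof.
move=> /subnK <-; move: (k - n)%N => {}k T; rewrite /central_tiles.
have -> : (k + n + (k + n) = k + (n + n) + k)%N by lia.
rewrite (window_cat _ _ (k + (n + n)) k) (window_cat _ _ k (n + n)) (window_cat _ _ k n).
have -> : - (k + n)%N%:Z + k%:Z = - n%:Z by lia.
rewrite !word_tiles_cat !mem_cat tlen_cat opprD addrAC addNr add0r.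
by move=> ->; rewrite orbT.
Qed.

Lemma seq_tiling_tiles x : tiles t (seq_tiling x) setT.
Proof.
split.
  apply/seteqP; split=> // r _.
  have [N HN] := len_unbounded t `|r|.
  have h1 := HN (window x (- N%:Z) N); have h2 := HN (window x (- N%:Z + N%:Z) N).
  rewrite !size_window leqnn in h1 h2.
  have {}h1 := h1 isT; have {}h2 := h2 isT.
  have h3 := ler_norm r; have := ler_norm (- r); rewrite normrN => h4.
  have E : len (window x (- N%:Z) (N + N)) =
      len (window x (- N%:Z) N) + len (window x (- N%:Z + N%:Z) N).
    by rewrite window_cat tlen_cat.
  have [|T Tw /andP[T1 T2]] := @word_tiles_cover _ _ t (- len (window x (- N%:Z) N))
      (window x (- N%:Z) (N + N)) r.
    by rewrite E addKr; apply/andP; split; lra.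
  exists T; first by exists N.
  by rewrite /tile_supp /= in_itv /= T1 ltW.
move=> T T' [n _ nT] [n' _ n'T'].
apply: (@word_tiles_disjoint _ _ t (- len (window x (- (maxn n n')%:Z) (maxn n n')))
  (window x (- (maxn n n')%:Z) (maxn n n' + maxn n n'))).
  by apply: (@central_tiles_sub _ n); rewrite ?leq_maxl.
by apply: (@central_tiles_sub _ n'); rewrite ?leq_maxr.
Qed.

(** A patch is finite, hence contained in a central patch, where it consists of exactly the tiles
    lying inside its interval; its labels thus form a subword of a window of [x]. *)
Lemma seq_tiling_patch x P w : X x -> P `<=` seq_tiling x ->
  is_patch t P -> label_word P w -> allowed zeta w.
Proof.
move=> xX PS [c [d [cd tP]]] [s [ss PE ->]].
have [n sn] : exists n, {subset s <= central_tiles x n}.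
  have : [set` s] `<=` seq_tiling x by rewrite -PE.
  elim: s {ss PE} => [|T s IH] sS; first by exists 0%N.
  have [|n Hn] := IH; first by move=> T' T's; apply: sS; rewrite /= in_cons [_ \in _]T's orbT.
  have [k _ Tk] := sS T (mem_head _ _).
  exists (maxn n k) => T'; rewrite in_cons => /orP[/eqP ->|T's].
    by apply: (central_tiles_sub (leq_maxr _ _)).
  by apply: (central_tiles_sub (leq_maxl _ _)); exact: Hn.
have sE : s = [seq T <- central_tiles x n | (c <= T.1) && (tile_end t T <= d)].
  apply: (irr_sorted_eq (leT := fun T T' : tile => T.1 < T'.1)) => //.
  - by move=> T2 T1 T3; exact: lt_trans.
  - apply: sorted_filter; first by move=> T2 T1 T3; exact: lt_trans.
    exact: word_tiles_sorted.
  move=> T; rewrite mem_filter; apply/idP/idP => [Ts|/andP[/andP[cT Td] Tn]].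
    have PT : P T by rewrite PE.
    have [-> ->] := tile_in_itv tP PT.
    exact: sn.
  (* The midpoint of [T] is covered by a tile of [P], which is [T] itself by disjointness. *)
  have TE := tile_lt_end t T.
  have : `[c, d]%classic ((T.1 + tile_end t T) / 2).
    by rewrite /= in_itv /=; apply/andP; split; lra.
  rewrite -tP.1 => -[T' PT']; rewrite /tile_supp /= in_itv /= => /andP[h1 h2].
  have T's : T' \in s by move: PT'; rewrite PE.
  suff -> : T = T' by [].
  apply: (tile_overlap (proj2 (seq_tiling_tiles x))).
  - by exists n.
  - by exists n => //; exact: sn.
  - by apply: lt_le_trans h2; lra.
  - by apply: le_lt_trans h1 _; lra.
have [w' w'w e] := filter_word_tiles c d (- len (window x (- n%:Z) n))
  (window x (- n%:Z) (n + n)).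
rewrite sE e; apply: (allowed_infix w'w); exact: allowed_window.
Qed.

Lemma tiling_of_seq x c : X x -> exists S : tiling_space t zeta,
  forall n, [set` word_tiles t c (window x 0 n)] `<=` val S.
Proof.
move=> xX.
have SX : seq_tiling x \in subst_tilings t zeta.
  rewrite inE; split; first exact: seq_tiling_tiles.
  by move=> P w; exact: seq_tiling_patch.
pose S : tiling_space t zeta := exist (fun S => S \in subst_tilings t zeta) _ SX.
exists (tiling_flow t zeta (- c) S) => n /=.
have {1}-> : c = 0 - - c by rewrite sub0r opprK.
rewrite -translate_word_tiles; apply: image_subset => T Tn.
exists n => //; rewrite /central_tiles /= window_cat word_tiles_cat addNr addNr.
by rewrite mem_cat [T \in word_tiles _ 0 _]Tn orbT.
Qed.

Lemma word_tiles_allowed (S : tiling_space t zeta) c w : w != [::] ->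
  [set` word_tiles t c w] `<=` val S -> allowed zeta w.
Proof.
move=> w0 wS; have [_ aS] := set_mem (valP S).
by apply: aS wS _ _; [exact: word_tiles_patch | exact: word_tiles_label].
Qed.

End SeqTiling.

(** * Mixing of the tiling flow and of words *)

Section TilingMixing.
Variables (R : realType) (m : nat) (t : 'I_m -> {posnum R}) (zeta : substitution m).
Local Notation tile := (tile R m).
Local Notation ts := (fun i => (t i)%:num).
Local Notation len := (tlen ts).
Local Notation X := (subst_seqs zeta).
Implicit Types (c d y z g : R) (x : biseq m) (u v w : seq 'I_m).

Lemma open_tiling_base (P : set tile) d : is_patch t P -> 0 < d ->
  open (tiling_base (t := t) (zeta := zeta) (P, d)).
Proof.
by move=> PP d0; exists [set (P, d)]; [move=> _ -> | rewrite bigcup_set1].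
Qed.

(** Inside a basic neighbourhood the patch is extended to the right from its first tile until it
    covers the original one; the offset [y] already used is taken off the tolerance. *)
Lemma open_sub_word_tiles (U : set (tiling_space t zeta)) S : open U -> U S ->
  exists c w d, [/\ 0 < d, w != [::], [set` word_tiles t c w] `<=` val S &
    forall S' z, `|z| < d -> [set` word_tiles t (c - z) w] `<=` val S' -> U S'].
Proof.
move=> [D DB <-] [[P d] DPd [y yd yP]].
have [pP d0] := DB _ DPd; have [tS _] := set_mem (valP S).
have [c [c' [cc' tP]]] := patch_translate y pP.
have [[A PA Ac] _] := patch_ends cc' tP.
have [N HN] := len_unbounded t (c' - c).
have [w [wN wS]] := word_tiles_extend N tS (yP _ PA).
exists c, (A.2 :: w), (d - `|y|); split => //.
- by rewrite subr_gt0 ltr_norml.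
- by rewrite -Ac.
move=> S' z zd wS'; exists (P, d) => //; exists (z + y) => /=.
  by rewrite -ltr_norml (le_lt_trans (ler_normD _ _))// -ltrBrDr.
rewrite -translateD; apply: subset_trans wS'; rewrite -translate_word_tiles.
apply: image_subset => T PT; rewrite -Ac.
have [cT Tc'] := tile_in_itv tP PT.
apply: (mem_word_tiles_itv tS wS); first exact: yP.
rewrite Ac cT /=; have := tile_lt_end t T.
have : c' - c < len (A.2 :: w) by apply: HN; rewrite /= wN.
by move=> *; lra.
Qed.

Lemma tiling_mixing_of_words :
  (forall d u v, 0 < d -> allowed zeta u -> allowed zeta v ->
    word_mixing ts zeta d u v) ->
  topologically_mixing (tiling_flow t zeta).
Proof.
move=> mix U V oU oV [S US] [S' VS'].
have [c1 [u [d1 [d10 u0 /(word_tiles_allowed u0) uA Hu]]]] := open_sub_word_tiles oU US.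
have [c2 [v [d2 [d20 v0 /(word_tiles_allowed v0) vA Hv]]]] := open_sub_word_tiles oV VS'.
pose d := Num.min d1 d2.
have d0 : 0 < d by rewrite lt_min d10.
have dd1 : d <= d1 by rewrite ge_min lexx.
have dd2 : d <= d2 by rewrite ge_min lexx orbT.
have [r Hr] := mix _ _ _ d0 vA uA; have [q Hq] := mix _ _ _ d0 uA vA.
exists (`|r| + `|q| + `|c1 - c2| + 1); first by rewrite ltr_wpDl// !addr_ge0.
move=> g gr.
suff [T [z1 [z2 [z1d z2d uT vT]]]] : exists T : tiling_space t zeta, exists z1 z2,
    [/\ `|z1| < d, `|z2| < d, [set` word_tiles t (c1 + g - z1) u] `<=` val T &
      [set` word_tiles t (c2 - z2) v] `<=` val T].
  exists (tiling_flow t zeta g T); split.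
    apply: (Hu _ z1); first exact: lt_le_trans dd1.
    have -> : c1 - z1 = c1 + g - z1 - g by ring.
    by rewrite -translate_word_tiles; apply: image_subset.
  by exists T => //; apply: (Hv _ z2) => //; exact: lt_le_trans dd2.
have sub x c s n : [set` word_tiles t (c + len (window x 0 s)) (window x s%:Z n)]
    `<=` [set` word_tiles t c (window x 0 (s + n))].
  move=> T Ts; rewrite /= window_cat word_tiles_cat add0r mem_cat.
  by rewrite [X in _ || X]Ts orbT.
have n1 := ler_norm (c1 - c2); have := ler_norm (- (c1 - c2)); rewrite normrN => n2.
have n3 := normr_ge0 r; have n4 := normr_ge0 q.
(* The word lying further left is placed exactly; the offset of the other one absorbs the error of
   the word mixing. *)
have [g0|g0] := leP 0 g.
  rewrite (ger0_norm g0) in gr.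
  have [|x xX [s [x0 xs sg]]] := Hr (c1 + g - c2); first by have := ler_norm r; lra.
  have [T HT] := tiling_of_seq t c2 xX.
  exists T, (c1 + g - c2 - len (window x 0 s)), 0; split.
  - by rewrite distrC.
  - by rewrite normr0.
  - apply: subset_trans (HT (s + size u)%N); apply: subset_trans (sub _ _ _ _).
    by rewrite xs; have -> : c1 + g - (c1 + g - c2 - len (window x 0 s)) =
      c2 + len (window x 0 s) by ring.
  - by rewrite subr0 -x0; exact: HT.
rewrite (ltr0_norm g0) in gr.
have [|x xX [s [x0 xs sg]]] := Hq (c2 - c1 - g); first by have := ler_norm q; lra.
have [T HT] := tiling_of_seq t (c1 + g) xX.
exists T, 0, (c2 - c1 - g - len (window x 0 s)); split.
- by rewrite normr0.
- by rewrite distrC.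
- by rewrite subr0 -x0; exact: HT.
- apply: subset_trans (HT (s + size v)%N); apply: subset_trans (sub _ _ _ _).
  by rewrite xs; have -> : c2 - (c2 - c1 - g - len (window x 0 s)) =
    c1 + g + len (window x 0 s) by ring.
Qed.

(** The open sets consist of the tilings with [u], respectively [v], starting within [d / 2] of 0.
    Flowing by [-h] brings [v] within [d / 2] of [h], and a patch reaching past [v] spells an
    allowed word containing both. *)
Lemma word_mixing_of_tiling : topologically_mixing (tiling_flow t zeta) ->
  forall d u v, 0 < d -> allowed zeta u -> allowed zeta v ->
    (0 < size u)%N -> (0 < size v)%N -> word_mixing ts zeta d u v.
Proof.
move=> mix d u v d0 uA vA; rewrite !lt0n !size_eq0 => u0 v0.
have d20 : 0 < d / 2 by rewrite divr_gt0.
have B w : w != [::] -> allowed zeta w -> let B := tiling_base (t := t) (zeta := zeta)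
    ([set` word_tiles t 0 w], d / 2) in open B /\ B !=set0.
  move=> w0 wA; split; first by apply: open_tiling_base => //; exact: word_tiles_patch.
  have [x xX xw] := allowed_at0 wA; have [S HS] := tiling_of_seq t 0 xX.
  exists S; exists 0; first by rewrite /= oppr_lt0 d20.
  by rewrite translate0 -xw; exact: HS.
have [oU U0] := B _ u0 uA; have [oV V0] := B _ v0 vA.
have [r r0 Hr] := mix _ _ oU oV U0 V0.
exists (r + d) => h hr.
have h0 : 0 < h by lra.
have [|S [[y yd uS] [S2 [z zd vS2] SE]]] := Hr (- h).
  by rewrite normrN gtr0_norm//; lra.
have [tS _] := set_mem (valP S).
rewrite /= translate_word_tiles sub0r in uS.
rewrite /= translate_word_tiles sub0r in vS2.
rewrite /= in yd zd.
have vS : [set` word_tiles t (h - z) v] `<=` val S.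
  rewrite -SE /=; have -> : h - z = - z - - h by ring.
  by rewrite -translate_word_tiles; exact: image_subset.
have [T uT ST] : exists2 T, T.1 = - y & val S T.
  case: u u0 uS {B oU U0 Hr uA} => // i u _ uS.
  by exists (- y, i) => //; apply: uS; rewrite /= mem_head.
have [N HN] := len_unbounded t (h - z + y + len v).
have [W' [W'N WS]] := word_tiles_extend (N + size u)%N tS ST.
set W := _ :: W' in WS; rewrite uT in WS.
have WA : allowed zeta W by apply: word_tiles_allowed WS.
have lW : h - z + y + len v < len W by apply: HN; rewrite /= W'N leqW// leq_addr.
have uW : (size u <= size W)%N by rewrite /= W'N leqW// leq_addl.
clearbody W.
have [A Az SA] : exists2 A, A.1 = h - z & val S A.
  case: v v0 vS {B oV V0 Hr vA HN lW vS2} => // i v _ vS.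
  by exists (h - z, i) => //; apply: vS; rewrite /= mem_head.
have AW : A \in word_tiles t (- y) W.
  apply: (mem_word_tiles_itv tS WS SA); rewrite Az.
  by have := len_ge0 t v; move: yd zd => /andP[? ?] /andP[? ?] ?; apply/andP; split; lra.
have [W1 [W2 [WE W1E]]] := mem_word_tiles AW.
have Wu : take (size u) W = u.
  exact: (word_tiles_prefix tS uS WS).
have W2S : [set` word_tiles t (h - z) (A.2 :: W2)] `<=` val S.
  apply: subset_trans WS => B' B'W.
  by rewrite /= WE word_tiles_cat mem_cat -W1E Az [X in _ || X]B'W orbT.
have lW1 : h - z = - y + len W1 by rewrite -Az.
have W2v : take (size v) (A.2 :: W2) = v.
  have [le|lt] := leqP (size v) (size (A.2 :: W2)).
    exact: (word_tiles_prefix tS vS W2S le).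
  (* Were the rest of [W] shorter than [v], it would be a prefix of [v], and [W] would end no later
     than [v], against the choice of [N]. *)
  have := word_tiles_prefix tS W2S vS (ltnW lt) => e.
  have := cat_take_drop (size (A.2 :: W2)) v; rewrite {}e => e.
  have dv := len_ge0 t (drop (size (A.2 :: W2)) v).
  have {}e : len v = len (A.2 :: W2) + len (drop (size (A.2 :: W2)) v).
    by rewrite -{1}e tlen_cat.
  have W12 : len W = len W1 + len (A.2 :: W2) by rewrite WE tlen_cat.
  by exfalso; clear -lW lW1 dv e W12; lra.
have [x xX xW] := allowed_at0 WA.
exists x => //; exists (size W1).
have Wcat u1 u2 : W = u1 ++ u2 -> window x 0 (size u1) = u1 /\
    forall u3 u4, u2 = u3 ++ u4 -> window x (size u1)%:Z (size u3) = u3.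
  move=> e; split=> [|u3 u4 e3].
    by move: xW; rewrite e -[u1 ++ u2]/([::] ++ u1 ++ u2) => /window_infix; rewrite add0r.
  by move: xW; rewrite e e3 => /window_infix; rewrite add0r.
have [_ /(_ _ _ (esym (cat_take_drop (size v) (A.2 :: W2))))] := Wcat _ _ WE.
have [xW1 _] := Wcat _ _ WE.
have [+ _] := Wcat _ _ (esym (cat_take_drop (size u) W)).
rewrite Wu W2v xW1 => xu xv; split=> //.
have -> : len W1 = h - z + y by rewrite lW1 addrAC addNr add0r.
move: yd zd => /andP[? ?] /andP[? ?].
by rewrite ltr_norml; apply/andP; split; lra.
Qed.

End TilingMixing.

(** * The theorem *)

Section Independence.
Variables (R : realType) (x y : R).
Hypotheses (x_gt0 : 0 < x) (xy_irrational : irrational (y / x)).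

Lemma irrational_independent (i j : int) :
  i%:~R * x + j%:~R * y = 0 -> i = 0 /\ j = 0.
Proof.
move=> ij; have [j0|j0] := eqVneq j 0.
  move: ij; rewrite j0 mul0r addr0 => /eqP; rewrite mulf_eq0 (gt_eqF x_gt0) orbF.
  by rewrite intr_eq0 => /eqP.
case: xy_irrational; exists (- i%:~R / j%:~R) => //.
rewrite fmorph_div rmorphN /= !ratr_int.
have j0' : j%:~R != 0 :> R by rewrite intr_eq0.
have x0' := lt0r_neq0 x_gt0.
by apply/eqP; rewrite eqr_div//; apply/eqP; lra.
Qed.

(** The nonzero integer vectors in the box are finite in number and give nonzero values; [d] is the
    least absolute value among these and 1. *)
Lemma irrational_separated (C : nat) : exists d : R, [/\ 0 < d, d <= 1 &
  forall i j : int, (absz i <= C)%N -> (absz j <= C)%N ->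
    `|i%:~R * x + j%:~R * y| < d -> i + j = 0].
Proof.
pose z (k : 'I_(C + C).+1) : int := k%:Z - C%:Z.
pose f (p : 'I_(C + C).+1 * 'I_(C + C).+1) : R :=
  if (z p.1 == 0) && (z p.2 == 0) then 1 else `|(z p.1)%:~R * x + (z p.2)%:~R * y|.
exists (\big[Num.min/1]_p f p); split.
- apply/lt_bigmin => [|p _]; first exact: ltr01.
  rewrite /f; case: ifP => [_|/negbT]; first exact: ltr01.
  rewrite negb_and normr_gt0; apply: contraL => /eqP/irrational_independent[-> ->].
  by rewrite eqxx.
- exact: bigmin_le_id.
- move=> i j iC jC.
  have ord (l : int) : (absz l <= C)%N -> exists k, z k = l.
    move=> lC; have lt : (absz (l + C%:Z)%R < (C + C).+1)%N by lia.
    by exists (Ordinal lt); rewrite /z /=; lia.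
  have [[k ki] [l lj]] := (ord _ iC, ord _ jC).
  have fkl : \big[Num.min/1]_p f p <= f (k, l) by exact: bigmin_le_cond.
  move=> /lt_le_trans/(_ fkl).
  rewrite /f /= ki lj; case: ifP => [/andP[/eqP -> /eqP ->] //|_].
  by rewrite ltxx.
Qed.
End Independence.

(** * Proportional letter counts force balance *)

Section Degenerate.
Variable (zeta : substitution 2).
Local Notation X := (subst_seqs zeta).
Local Notation a := (min_count zeta 0).
Local Notation b := (max_count zeta 0).
Hypothesis X_neq0 : X !=set0.
Implicit Types (u v w : seq 'I_2).

(* [zeros w * (p + q) - p * |w|] is additive, and vanishes on words inflated by
   [zeta^k] when the frequency of 0 is [p / (p + q)] in both [zeta^k(0)] and
   [zeta^k(1)]. *)
Lemma proportional_bounded k :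
  (count_mem 0%R (subst_iter zeta k 0%R) * count_mem 1%R (subst_iter zeta k 1%R) =
   count_mem 1%R (subst_iter zeta k 0%R) * count_mem 0%R (subst_iter zeta k 1%R))%N ->
  exists K, forall n, (b n <= a n + K)%N.
Proof.
set z0 := subst_iter zeta k 0; set z1 := subst_iter zeta k 1.
move=> prop.
pose D w : int := (count_mem 0%R w * size z0)%N%:Z - (count_mem 0%R z0 * size w)%N%:Z.
have D_cat u v : D (u ++ v) = D u + D v.
  by rewrite /D count_cat size_cat mulnDl mulnDr !PoszD; ring.
have D_le w : (absz (D w) <= size z0 * size w)%N.
  have h1 := leq_mul (count_size (pred1 (0 : 'I_2)) w) (leqnn (size z0)).
  have h2 := leq_mul (count_size (pred1 (0 : 'I_2)) z0) (leqnn (size w)).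
  rewrite (mulnC (size w)) in h1; rewrite /D.
  move: h1 h2; move: (count_mem 0%R w * _)%N (count_mem 0%R z0 * _)%N (size z0 * _)%N => p q r.
  by clear; lia.
have D_z i : D (subst_iter zeta k i) = 0.
  have [->|/ord2_neq0 ->] := eqVneq i 0; rewrite /D -/z0 -/z1; first by rewrite subrr.
  by rewrite -(count_mem01 z0) -(count_mem01 z1); nia.
(* In a prefix of an inflated word only the last, incomplete block contributes to [D], and it has at
   most [size z0 + size z1] letters. *)
pose E := (size z0 * (size z0 + size z1))%N.
have D_prefix V p : prefix p (iter k (subst_word zeta) V) -> (absz (D p) <= E)%N.
  elim: V p => [|i V IH] p.
    by rewrite iter_subst_nil prefixs0 => /eqP ->; rewrite /D /= muln0.
  rewrite -cat1s iter_subst_cat -/(subst_iter zeta k i) => pV.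
  have [le|lt] := leqP (size p) (size (subst_iter zeta k i)).
    apply: leq_trans (D_le p) _; rewrite leq_mul// (leq_trans le)//.
    by have [->|/ord2_neq0 ->] := eqVneq i 0; rewrite ?leq_addr ?leq_addl.
  move: pV; rewrite prefixE take_cat ltnNge (ltnW lt) /= => /eqP <-.
  by rewrite D_cat D_z add0r IH// prefix_take.
have D_allowed w : allowed zeta w -> (absz (D w) <= 2 * E)%N.
  move=> /allowed_infix_iter[K HK].
  (* The exponent [k + K] yields an image under [zeta^k], in which [w] is the difference of two
     prefixes. *)
  have := HK (k + K)%N 0 (leq_addl _ _).
  rewrite /subst_iter iterD => /infixP[s [s' e]].
  have p1 := @D_prefix (iter K (subst_word zeta) [:: 0]) s.
  have p2 := @D_prefix (iter K (subst_word zeta) [:: 0]) (s ++ w).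
  have {}p1 := p1 (ltac:(by rewrite e prefix_prefix)).
  have {}p2 := p2 (ltac:(by rewrite e catA prefix_prefix)).
  by rewrite D_cat in p2; lia.
exists (4 * E)%N => n.
have [x xX [i <-]] := max_count_window 0 X_neq0 n.
have [y yX [j <-]] := min_count_window 0 X_neq0 n.
have := D_allowed _ (allowed_window i n xX).
have := D_allowed _ (allowed_window j n yX).
rewrite /D !size_window; have := subst_iter_gt0 zeta k 0; rewrite -/z0.
clearbody E; move: (size z0) (count_mem 0%R z0 * n)%N => z r.
move: (count_mem 0%R (window x i n)) (count_mem 0%R (window y j n)) => p q.
move=> z_gt0 Dq Dp; rewrite leqNgt; apply/negP => pq; move: Dp Dq.
have : ((q + 4 * E).+1 * z <= p * z)%N by rewrite leq_mul2r pq orbT.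
have : (4 * E + 1 <= (4 * E + 1) * z)%N by rewrite leq_pmulr.
by rewrite mulSn mulnDl mulnDl mul1n; clear; lia.
Qed.
End Degenerate.

Lemma nat_cvgyP (f : nat -> nat) : f @ \oo --> \oo <->
  forall A, exists N, forall n, (N <= n)%N -> (A <= f n)%N.
Proof.
split=> [/cvgnyPge H A|H]; first by have [N _ HN] := H A; exists N.
by apply/cvgnyPge => A; have [N HN] := H A; exists N.
Qed.

(** * The two equivalences *)

Section Main.
Variables (R : realType) (zeta : substitution 2).
Local Notation a := (min_count zeta 0).
Local Notation b := (max_count zeta 0).
Local Notation X := (subst_seqs zeta).
Hypotheses (zeta_primitive : primitive zeta) (X_neq0 : X !=set0).

Lemma not_cvg_bounded_often : ~ ((fun n => (b n - a n)%N) @ \oo --> \oo) ->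
  exists K, forall N, exists2 n, (N <= n)%N & (b n <= a n + K)%N.
Proof.
move=> /nat_cvgyP/existsNP[K HK]; exists K => N; apply: contrapT => HN.
apply: HK; exists N => n Nn; rewrite leqNgt; apply/negP => lt; apply: HN.
by exists n => //; rewrite -leq_subLR ltnW.
Qed.

Lemma shift_mixing_iff :
  (forall n, (1 <= n)%N ->
    gcdn (size (subst_iter zeta n 0)) (size (subst_iter zeta n 1)) = 1%N) ->
  topologically_mixing (subst_shift zeta) <->
  (fun n => (b n - a n)%N) @ \oo --> \oo.
Proof.
move=> gcd1; split=> [/(word_mixing_of_shift R) mix|/nat_cvgyP ab].
  apply: contrapT => /not_cvg_bounded_often[K HK].
  apply: (@balanced_not_mixing_unit R zeta X_neq0 K) => // [|u v uA vA _ _]; last exact: mix.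
  (* For unit lengths separation holds with [d = 1]: an integer of absolute value less than 1
     vanishes. *)
  apply: (@mixing_bounded R zeta X_neq0 (fun=> 1)) => // C; exists 1; split=> //.
    by move=> i j _ _; rewrite !mulr1 -intrD -intr_norm (ltr_int R _ 1); lia.
  by move=> u v uA vA _ _; exact: mix.
apply: (@shift_mixing_of_words R) => u v.
apply: unbalanced_word_mixing => // k k0.
rewrite !tlen1; apply: approximable_coprime.
by rewrite /coprime gcd1.
Qed.

Lemma tiling_mixing_iff (t : 'I_2 -> {posnum R}) :
  irrational ((t 1)%:num / (t 0)%:num) ->
  topologically_mixing (tiling_flow t zeta) <->
  (fun n => (b n - a n)%N) @ \oo --> \oo.
Proof.
move=> irr; have t0 (i : 'I_2) : 0 < (t i)%:num by [].
split=> [/word_mixing_of_tiling mix|cvg].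
  apply: contrapT => /not_cvg_bounded_often[K HK].
  apply: (@balanced_not_mixing_real R zeta X_neq0 K (fun i => (t i)%:num)) => //.
  apply: (@mixing_bounded R zeta X_neq0 (fun i => (t i)%:num)) => // C.
  have [d [d0 d1 sep]] := irrational_separated (t0 0) irr C.
  by exists d; split=> // u v uA vA u0 v0; exact: mix.
have /nat_cvgyP ab := cvg.
apply: tiling_mixing_of_words => d u v d0.
apply: unbalanced_word_mixing => // k k0.
apply: approximable_independent => //.
  by apply: tlen_gt0 => //; exact: subst_iter_gt0.
(* Vanishing of the determinant of the counts in [zeta^k(0)] and [zeta^k(1)] would bound [b - a].
   Hence it is nonzero, and independence passes from the tile lengths to the inflated lengths. *)
have [/(proportional_bounded X_neq0)[K HK]|/eqP prop] := eqVneq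
  (count_mem 0%R (subst_iter zeta k 0%R) * count_mem 1%R (subst_iter zeta k 1%R))%N
  (count_mem 1%R (subst_iter zeta k 0%R) * count_mem 0%R (subst_iter zeta k 1%R))%N.
  have [N /(_ N (leqnn N))] := ab K.+1.
  by rewrite ltnNge leq_subLR HK.
move=> i j; rewrite !tlenE -!count_mem01.
move: (count_mem 0 (subst_iter zeta k 0)) (count_mem 1 (subst_iter zeta k 0))
  (count_mem 0 (subst_iter zeta k 1)) (count_mem 1 (subst_iter zeta k 1)) prop
  => A B C D prop ij.
have [] := irrational_independent (t0 0) irr
  (_ : (i * A%:Z + j * C%:Z)%:~R * _ + (i * B%:Z + j * D%:Z)%:~R * _ = 0).
  by rewrite -{}ij !intrD !intrM -!pmulrn !natrD; ring.
move=> e1 e2.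
(* Cramer's rule: the determinant times [i] and times [j] is zero. *)
have ne : A%:Z * D%:Z - B%:Z * C%:Z != 0 by lia.
have i0 : i * (A%:Z * D%:Z - B%:Z * C%:Z) = 0.
  rewrite (_ : _ * _ = (i * A%:Z + j * C%:Z) * D%:Z - (i * B%:Z + j * D%:Z) * C%:Z); last ring.
  by rewrite e1 e2 !mul0r subrr.
have j0 : j * (A%:Z * D%:Z - B%:Z * C%:Z) = 0.
  rewrite (_ : _ * _ = (i * B%:Z + j * D%:Z) * A%:Z - (i * A%:Z + j * C%:Z) * B%:Z); last ring.
  by rewrite e1 e2 !mul0r subrr.
by move: i0 j0 => /eqP + /eqP; rewrite !mulf_eq0 (negbTE ne) !orbF => /eqP -> /eqP ->.
Qed.

End Main.

Theorem theorem1p4 (R : realType) (zeta : substitution 2)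
    (zeta_primitive : primitive zeta) (zeta_aperiodic : aperiodic zeta) :
  let a := min_count zeta 0 in
  let b := max_count zeta 0 in
  ((forall n : nat, (1 <= n)%N ->
      gcdn (size (subst_iter zeta n 0)) (size (subst_iter zeta n 1)) = 1%N) ->
    (topologically_mixing (subst_shift zeta) <->
      (fun n => (b n - a n)%N) @ \oo --> \oo)) /\
  (forall t : 'I_2 -> {posnum R}, irrational ((t 1)%:num / (t 0)%:num) ->
    (topologically_mixing (tiling_flow t zeta) <->
      (fun n => (b n - a n)%N) @ \oo --> \oo)).
Proof.
have X_neq0 : subst_seqs zeta !=set0.
  by apply/set0P/negP => /eqP X0; apply: zeta_aperiodic; rewrite X0.
by split; [exact: shift_mixing_iff | exact: tiling_mixing_iff].
Qed.
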